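(* For every integer $n\ge 1$ there exist integers $G_{10n}$ and $H_{10n}$ such that $$C_{10n}=\sum_{\substack{p\equiv 1 \bmod 5\\ p-1\mid 10n}}\frac{A_p^{10n/(p-1)}}{p}+G_{10n},$$ $$D_{10n}=\sum_{\substack{p\equiv 1 \bmod 5\\ p-1\mid 10n}}\frac{(4!^{-1}\bmod p)\,A_p^{10n/(p-1)}}{p}+H_{10n},$$ where the sums run over prime numbers $p$ with $p\equiv 1 \pmod 5$ and $(p-1)\mid 10n$, and $$A_p=(-1)^{(p-1)/10}\binom{(p-1)/2}{(p-1)/10}.$$
   Context: Let $C$ be the (smooth projective) curve of genus $2$ defined by $y^2=x^5-1$, and let $\infty$ be its unique point at infinity. Consider the integral $u=\int_{\infty}^{(x,y)}\frac{x\,dx}{2y}$ (an integral of a differential of the first kind which does not vanish at $\infty$). Near $\infty$ the quantity $u$ is a local parameter on $C$ vanishing at $\infty$, so the coordinate functions $x$ and $y$ can be expressed, in a neighborhood of $u=0$, as Laurent series $x(u)$, $y(u)$ in $u$. They satisfy $y(u)^2=x(u)^5-1$, $x'(u)=2y(u)/x(u)$ and $x(u)^2x'(u)^2=4x(u)^5-4$. Only exponents of the following form occur, and the rational numbers $C_{10n}$, $D_{10n}$ ($n\ge 1$) are defined by $$x(u)=\frac{1}{u^2}+\sum_{n=1}^{\infty}\frac{C_{10n}}{10n}\,\frac{u^{10n-2}}{(10n-2)!},\qquad y(u)=\frac{-1}{u^5}+\sum_{n=1}^{\infty}\frac{D_{10n}}{10n}\,\frac{u^{10n-5}}{(10n-5)!}.$$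 The symbol $(4!^{-1}\bmod p)$ denotes an integer representing the inverse of $4!=24$ modulo $p$. (Every prime $p\equiv 1\pmod 5$ is odd, hence $p\equiv 1\pmod{10}$.) *)

(* Defs.v *)
From HB Require Import structures.
From mathcomp Require Import all_boot all_order all_algebra.

Set Implicit Arguments.
Unset Strict Implicit.
Unset Printing Implicit Defensive.

Import Order.TTheory GRing.Theory Num.Theory.

Local Open Scope ring_scope.

(* [Laurent v a] is the formal Laurent series \sum_(k >= 0) a k * u ^ (v + k).
   The first coefficients a 0, a 1, ... may vanish, so [lmin] is only a lower
   bound for the valuation and one series has several representations; series
   are therefore compared with [leq_series], i.e. coefficientwise. *)
Record laurent (R : Type) := Laurent { lmin : int; lseq : nat -> R }.

Section LaurentSeries.
Variable R : comNzRingType.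
Implicit Types (f g : laurent R) (c : R) (m : int).

Definition lcoef f m : R :=
  if lmin f <= m then lseq f `|m - lmin f|%N else 0.

Definition leq_series f g : Prop := forall m, lcoef f m = lcoef g m.

Definition lconst c : laurent R := Laurent 0 (fun k => if k == 0%N then c else 0).

Definition lvar : laurent R := Laurent 1 (fun k => if k == 0%N then 1 else 0).

Definition lsub f g : laurent R :=
  let v := Order.min (lmin f) (lmin g) in
  Laurent v (fun k => lcoef f (v + k%:Z) - lcoef g (v + k%:Z)).

Definition lmul f g : laurent R :=
  Laurent (lmin f + lmin g)
    (fun k => \sum_(i < k.+1) lseq f i * lseq g (k - i)%N).

Definition lexp f (n : nat) : laurent R := iter n (lmul f) (lconst 1).

Definition lderiv f : laurent R :=
  Laurent (lmin f - 1) (fun k => (lmin f + k%:Z)%:~R * lseq f k).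

Definition has_pole f : Prop := exists2 m, m < 0 & lcoef f m != 0.

End LaurentSeries.

Declare Scope laurent_scope.
Delimit Scope laurent_scope with L.
Bind Scope laurent_scope with laurent.
Notation "f == g" := (leq_series f g) : laurent_scope.
Notation "f - g" := (lsub f g) : laurent_scope.
Notation "f * g" := (lmul f g) : laurent_scope.
Notation "f ^+ n" := (lexp f n) : laurent_scope.
Notation "c %:L" := (lconst c) (at level 2, left associativity, format "c %:L")
  : laurent_scope.

(* x and y are the expansions, in powers of u, of the coordinate functions of
   the curve y^2 = x^5 - 1 at its point at infinity, for the local parameter
   u = \int_oo^(x,y) x dx / (2y).  The three clauses say that u |-> (x, y)
   parametrizes the curve, that u = 0 is mapped to the point at infinity, and
   that du = x dx / (2y), with the denominator cleared.  The solution is unique;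
   the leading terms u^-2 of x and -u^-5 of y are forced by these equations. *)
Definition expansion_at_infinity (x y : laurent rat) : Prop :=
  [/\ (y ^+ 2 == x ^+ 5 - 1%:L)%L,
      has_pole x
    & (2%:L * y * lderiv (lvar _) == x * lderiv x)%L].

(* The numbers C_(10n) and D_(10n), n >= 1, read off from
     x = u^-2 + \sum_n  C_(10n) / (10n) * u^(10n-2) / (10n-2)!
     y = - u^-5 + \sum_n  D_(10n) / (10n) * u^(10n-5) / (10n-5)!  *)
Definition C10 (x : laurent rat) (n : nat) : rat :=
  lcoef x (10 * n - 2)%N%:Z * (10 * n - 2)`!%:R * (10 * n)%:R.

Definition D10 (y : laurent rat) (n : nat) : rat :=
  lcoef y (10 * n - 5)%N%:Z * (10 * n - 5)`!%:R * (10 * n)%:R.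

Definition A (p : nat) : int :=
  (-1) ^+ (p.-1 %/ 10) * 'C(p.-1 %/ 2, p.-1 %/ 10)%:Z.

Definition admissible (n p : nat) : bool :=
  [&& prime p, p == 1 %[mod 5] & p.-1 %| 10 * n]%N.

(* Main.v *)
Require Import Defs.
From HB Require Import structures.
From mathcomp Require Import all_boot all_order all_algebra.
From mathcomp Require Import boolp.
From mathcomp Require Import ring zify.

Set Implicit Arguments.
Unset Strict Implicit.
Unset Printing Implicit Defensive.

Import Order.TTheory GRing.Theory Num.Theory.

Local Open Scope ring_scope.

(* Put x = 1 / s ^ 2 and y = - s' / s ^ 5, where s(u) is the inverse function of
   u = \int dq / sqrt (1 - q ^ 10); all s ^ i / i! have Hurwitz coefficients in Z.
   Integrating dq / (q ^ 2 sqrt (1 - q ^ 10)) termwise expresses C_m as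
     - \sum_j c_j / (j + 1) * (s ^ j)_m
   up to a multiple of 24, where (1 - q ^ 10) ^ (- 1/2) = \sum_j c_j q ^ j and
   (s ^ j)_m is the coefficient of u ^ m / m!; the relation
   x''' = 24 y + 24 s ^ 5 s' then gives D_m = C_m / 24 modulo Z.  The factor j!
   of (s ^ j)_m cancels every denominator j + 1 which is not a prime p = 1 mod 10.
   For such a prime, D = d/du satisfies D ^ p s = A_p s' modulo p, which yields
   D ^ (p - 1) (s ^ (p - 1)) = A_p s ^ (p - 1) - 1 modulo p and hence
   (s ^ (p - 1))_m; moreover c_(p - 1) = A_p modulo p. *)

(** * Hurwitz series *)

(* The Hurwitz series f stands for \sum_n hcoef f n * u ^ n / n`!. *)
Record hurwitz (R : Type) := Hurwitz { hcoef : nat -> R }.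

HB.instance Definition _ (R : Type) := gen_eqMixin (hurwitz R).
HB.instance Definition _ (R : Type) := gen_choiceMixin (hurwitz R).

Definition hderiv (R : Type) (f : hurwitz R) : hurwitz R :=
  Hurwitz (fun n => hcoef f n.+1).

Lemma hurwitzP (R : Type) (f g : hurwitz R) :
  (forall n, hcoef f n = hcoef g n) -> f = g.
Proof. by case: f g => f [g] fg; congr Hurwitz; apply: funext. Qed.

Section HurwitzRing.
Variable R : comNzRingType.
Implicit Types (f g h : hurwitz R) (a : R).

Definition hconst a : hurwitz R := Hurwitz (fun n => if n == 0%N then a else 0).

Definition hadd f g : hurwitz R := Hurwitz (fun n => hcoef f n + hcoef g n).
Definition hopp f : hurwitz R := Hurwitz (fun n => - hcoef f n).

Fact haddA : associative hadd.
Proof. by move=> f g h; apply: hurwitzP => n /=; rewrite addrA. Qed.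
Fact haddC : commutative hadd.
Proof. by move=> f g; apply: hurwitzP => n /=; rewrite addrC. Qed.
Fact hadd0 : left_id (hconst 0) hadd.
Proof. by move=> f; apply: hurwitzP => n /=; rewrite if_same add0r. Qed.
Fact haddN : left_inverse (hconst 0) hopp hadd.
Proof. by move=> f; apply: hurwitzP => n /=; rewrite if_same addNr. Qed.

HB.instance Definition _ :=
  GRing.isZmodule.Build (hurwitz R) haddA haddC hadd0 haddN.

Lemma hcoef0 n : hcoef (0 : hurwitz R) n = 0.
Proof. by rewrite /= if_same. Qed.
Lemma hcoefD f g n : hcoef (f + g) n = hcoef f n + hcoef g n.
Proof. by []. Qed.
Lemma hcoefN f n : hcoef (- f) n = - hcoef f n.
Proof. by []. Qed.
Lemma hcoefB f g n : hcoef (f - g) n = hcoef f n - hcoef g n.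
Proof. by []. Qed.
Lemma hcoef_sum (I : Type) (r : seq I) (P : pred I) (F : I -> hurwitz R) n :
  hcoef (\sum_(i <- r | P i) F i) n = \sum_(i <- r | P i) hcoef (F i) n.
Proof.
by apply: (big_morph (fun f => hcoef f n));
  [move=> f g; rewrite hcoefD | apply: hcoef0].
Qed.

(** The Leibniz rule serves as the definition of the product, in place of a binomial convolution, so
    that [hderivM] holds by conversion. *)
Fixpoint hmul_coef n f g : R :=
  if n is n'.+1 then hmul_coef n' (hderiv f) g + hmul_coef n' f (hderiv g)
  else hcoef f 0 * hcoef g 0.

Definition hmul f g : hurwitz R := Hurwitz (fun n => hmul_coef n f g).

Lemma hderivD f g : hderiv (f + g) = hderiv f + hderiv g.
Proof. by []. Qed.

Fact hmulC : commutative hmul.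
Proof.
move=> f g; apply: hurwitzP => n /=.
elim: n f g => [|n IHn] f g /=; first by rewrite mulrC.
by rewrite addrC IHn [X in _ + X]IHn.
Qed.

Fact hmulDl : left_distributive hmul +%R.
Proof.
move=> f g h; apply: hurwitzP => n; rewrite hcoefD /=.
elim: n f g h => [|n IHn] f g h /=; first by rewrite mulrDl.
by rewrite hderivD !IHn addrACA.
Qed.

Fact hmulA : associative hmul.
Proof.
move=> f g h; apply: hurwitzP => n.
elim: n f g h => [|n IHn] f g h; first by rewrite /= mulrA.
have hmul_deriv (f1 f2 : hurwitz R) :
    hderiv (hmul f1 f2) = hmul (hderiv f1) f2 + hmul f1 (hderiv f2) by [].
rewrite -[LHS]/(hcoef (hderiv _) n) -[RHS]/(hcoef (hderiv _) n) !hmul_deriv.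
rewrite hmulDl (hmulC f (_ + _)) hmulDl -!(hmulC f) !hcoefD !IHn.
by rewrite addrA.
Qed.

Fact hmul1 : left_id (hconst 1) hmul.
Proof.
move=> f; apply: hurwitzP => n /=.
have hmul0 k g : hmul_coef k (hconst 0) g = 0.
  have := congr1 (fun h => hcoef h k) (hmulDl (hconst 0) (hconst 0) g).
  rewrite [X in hmul X _](hadd0 (hconst 0)) hcoefD => /= /esym /eqP.
  by rewrite -subr_eq0 addrK => /eqP.
elim: n f => [|n IHn] f /=; first by rewrite mul1r.
have -> : hderiv (hconst 1) = hconst 0.
  by apply: hurwitzP => k; rewrite /= if_same.
by rewrite hmul0 add0r IHn.
Qed.

Fact hone_neq0 : hconst 1 != 0.
Proof.
by apply/eqP => /(congr1 (fun f => hcoef f 0)) /= /eqP; rewrite oner_eq0.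
Qed.

HB.instance Definition _ :=
  GRing.Zmodule_isComNzRing.Build (hurwitz R) hmulA hmulC hmul1 hmulDl hone_neq0.

Lemma hcoefM0 f g : hcoef (f * g) 0 = hcoef f 0 * hcoef g 0.
Proof. by []. Qed.
Lemma hcoefMS f g n :
  hcoef (f * g) n.+1 = hcoef (hderiv f * g) n + hcoef (f * hderiv g) n.
Proof. by []. Qed.
Lemma hcoefX0 f k : hcoef (f ^+ k) 0 = hcoef f 0 ^+ k.
Proof. by elim: k => [|k IHk]; rewrite ?expr0 // !exprS hcoefM0 IHk. Qed.

Lemma hderivM f g : hderiv (f * g) = hderiv f * g + f * hderiv g.
Proof. by []. Qed.
Lemma hderivN f : hderiv (- f) = - hderiv f.
Proof. by []. Qed.
Lemma hderivB f g : hderiv (f - g) = hderiv f - hderiv g.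
Proof. by []. Qed.
Lemma hderiv_const a : hderiv (hconst a) = 0.
Proof. by apply: hurwitzP => k; rewrite /= if_same. Qed.
Lemma hderiv0 : hderiv (0 : hurwitz R) = 0.
Proof. exact: hderiv_const. Qed.
Lemma hderiv1 : hderiv (1 : hurwitz R) = 0.
Proof. exact: hderiv_const. Qed.
Lemma hderiv_nat k : hderiv (k%:R : hurwitz R) = 0.
Proof.
by elim: k => [|k IHk];
  rewrite ?hderiv0 // -addn1 natrD hderivD IHk hderiv1 addr0.
Qed.
Lemma hcoefMn f k n : hcoef (f *+ k) n = hcoef f n *+ k.
Proof.
by elim: k => [|k IHk]; rewrite ?mulr0n ?hcoef0 // !mulrS hcoefD IHk.
Qed.
Lemma hcoef_natM k f n : hcoef (k%:R * f) n = k%:R * hcoef f n.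
Proof. by rewrite [in LHS]mulr_natl hcoefMn mulr_natl. Qed.

Lemma hderivX f k : hderiv (f ^+ k) = k%:R * f ^+ k.-1 * hderiv f.
Proof.
elim: k => [|k IHk]; first by rewrite expr0 hderiv1 !mul0r.
rewrite exprS hderivM IHk /=; case: k {IHk} => [|k] /=;
  first by rewrite expr0; ring.
by rewrite -!natr1 exprS; ring.
Qed.

(** Differentiation only shifts coefficients, so this holds over every ring. Most identities below
    are proved by comparing constant terms and derivatives. *)
Lemma hderiv_inj f g :
  hcoef f 0 = hcoef g 0 -> hderiv f = hderiv g -> f = g.
Proof.
move=> fg0 fgD; apply: hurwitzP => -[//|n].
exact: (congr1 (fun h => hcoef h n) fgD).
Qed.

Lemma hderiv_eq0 f : hderiv f = 0 -> f = hconst (hcoef f 0).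
Proof. by move=> f'0; apply: hderiv_inj => //; rewrite hderiv_const. Qed.

Lemma hcoef_constM a f n : hcoef (hconst a * f) n = a * hcoef f n.
Proof.
elim: n f => [|n IHn] f //.
by rewrite hcoefMS hderiv_const mul0r hcoef0 add0r IHn.
Qed.

Lemma hconstM a b : hconst (a * b) = hconst a * hconst b.
Proof.
by apply: hderiv_inj => //; rewrite hderivM !hderiv_const mul0r mulr0 addr0.
Qed.

Lemma hconst0 : hconst 0 = 0. Proof. by []. Qed.

Lemma hcoef_iter_deriv k f n : hcoef (iter k (@hderiv R) f) n = hcoef f (n + k).
Proof. by elim: k n => [|k IHk] n; rewrite ?addn0 //= IHk addSnnS. Qed.

Lemma iter_hderivD k f g :
  iter k (@hderiv R) (f + g) = iter k (@hderiv R) f + iter k (@hderiv R) g.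
Proof. by elim: k => //= k ->. Qed.

Lemma iter_hderivM k f g :
  iter k (@hderiv R) (f * g) =
  \sum_(i < k.+1) 'C(k, i)%:R *
     (iter i (@hderiv R) f * iter (k - i) (@hderiv R) g).
Proof.
pose Dn i := iter i (@hderiv R).
rewrite -!/(Dn _) -[LHS]/(Dn k (f * g)).
pose F n := \sum_(i < n.+1) 'C(n, i)%:R * (Dn i f * Dn (n - i)%N g).
rewrite -[RHS]/(F k); elim: k => [|k IHk].
  by rewrite /F big_ord1 bin0 mul1r.
rewrite [LHS]/= -/(Dn k _) IHk /F.
rewrite (big_morph (@hderiv R) hderivD hderiv0).
transitivity (\sum_(i < k.+1) ('C(k, i)%:R * (Dn i.+1 f * Dn (k - i)%N g)
    + 'C(k, i)%:R * (Dn i f * Dn (k.+1 - i)%N g))).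
  apply: eq_bigr => i _; rewrite !hderivM hderiv_nat mul0r add0r mulrDr.
  by rewrite (subSn (ltn_ord i : (i <= k)%N)).
rewrite big_split /= addrC [RHS]big_ord_recl [X in X + _ = _]big_ord_recl.
rewrite -addrA !bin0; congr (_ + _).
under [in RHS]eq_bigr => i _ do rewrite lift0 binS natrD mulrDl subSS.
rewrite big_split /= [X in _ = X + _]big_ord_recr /= bin_small // mul0r addr0.
by congr (_ + _); apply: eq_bigr => i _; rewrite lift0.
Qed.

(** * Truncation and order of vanishing *)

Definition heqmod N f g := forall i, (i < N)%N -> hcoef f i = hcoef g i.

Lemma heqmod_refl N f : heqmod N f f. Proof. by []. Qed.
Hint Resolve heqmod_refl : core.

Lemma heqmodM N f f' g g' :
  heqmod N f f' -> heqmod N g g' -> heqmod N (f * g) (f' * g').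
Proof.
move=> eqf eqg i; elim: i N f f' g g' eqf eqg => [|i IHi] N f f' g g' eqf eqg.
  by move=> N0; rewrite !hcoefM0 eqf ?eqg.
case: N eqf eqg => // N eqf eqg ltiN; rewrite !hcoefMS.
by congr (_ + _); apply: (IHi N) => // j ltjN; rewrite /= ?eqf ?eqg // ltnW.
Qed.

Lemma heqmodX N f f' k : heqmod N f f' -> heqmod N (f ^+ k) (f' ^+ k).
Proof. by move=> eqf; elim: k => // k IHk; rewrite !exprS; apply: heqmodM. Qed.

(** Every Leibniz term in which a derivative falls on [g] contains a coefficient of [f] of index
    below n, which vanishes. *)
Lemma hcoefM_low n f g : heqmod n f 0 ->
  hcoef (f * g) n = hcoef f n * hcoef g 0.
Proof.
elim: n f g => [|n IHn] f g f_low; first by rewrite hcoefM0.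
rewrite hcoefMS IHn; last first.
  by move=> i ltin; rewrite -[LHS]/(hcoef f i.+1) f_low // !hcoef0.
rewrite (@heqmodM n.+1 f 0 (hderiv g) (hderiv g)) // mul0r hcoef0 addr0 //.
Qed.

Lemma hexp_low f k : hcoef f 0 = 0 -> heqmod k (f ^+ k) 0.
Proof.
move=> f0; elim: k => [//|k IHk] [|n]; first by rewrite hcoefX0 f0 expr0n.
rewrite ltnS => ltnk;
  rewrite [RHS]hcoef0 -[LHS]/(hcoef (hderiv (f ^+ k.+1)) n) hderivX.
rewrite -mulrA hcoef_natM [k.+1.-1]/= (@heqmodM n.+1 _ 0 _ (hderiv f)) //.
  by rewrite mul0r hcoef0 mulr0.
by move=> i ltin; apply: IHk; apply: leq_trans ltin _.
Qed.

Lemma hcoef_exp_diag f k : hcoef f 0 = 0 ->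
  hcoef (f ^+ k) k = k`!%:R * hcoef f 1 ^+ k.
Proof.
move=> f0; elim: k => [|k IHk]; first by rewrite !expr0 mulr1.
rewrite -[LHS]/(hcoef (hderiv (f ^+ k.+1)) k) hderivX -mulrA hcoef_natM
  [k.+1.-1]/=.
rewrite hcoefM_low ?IHk; last exact: hexp_low.
by rewrite factS natrM exprSr !mulrA.
Qed.

End HurwitzRing.

#[export] Hint Resolve heqmod_refl : core.

(** * Integration, divided powers and substitution *)

Section HurwitzOps.
Variable R : comNzRingType.
Implicit Types (f g h : hurwitz R) (a : R) (c d : nat -> R).

Definition hint f : hurwitz R :=
  Hurwitz (fun n => if n is n'.+1 then hcoef f n' else 0).

Lemma hderiv_hint f : hderiv (hint f) = f.
Proof. exact: hurwitzP. Qed.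

Definition hvar : hurwitz R := hint 1.

Lemma hcoef_hvarMS f n : hcoef (hvar * f) n.+1 = n.+1%:R * hcoef f n.
Proof.
elim: n f => [|n IHn] f.
  by rewrite hcoefMS hderiv_hint mul1r hcoefM0 mul0r addr0 mul1r.
rewrite hcoefMS hderiv_hint mul1r IHn -[hcoef (hderiv f) n]/(hcoef f n.+1).
by rewrite -(natr1 n.+1) mulrDl mul1r addrC.
Qed.

Definition heuler f : hurwitz R := hvar * hderiv f.

Lemma hcoef_heuler f n : hcoef (heuler f) n = n%:R * hcoef f n.
Proof. by case: n => [|n]; rewrite ?hcoef_hvarMS // hcoefM0 !mul0r. Qed.

(** For f(0) = 0 this is the divided power f ^ k / k!, obtained by integration and so without any
    division; it is the source of the factor k! in s ^ k. *)
Fixpoint hdpow f k : hurwitz R :=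
  if k is k'.+1 then hint (hdpow f k' * hderiv f) else 1.

Lemma hexp_hdpow f k : hcoef f 0 = 0 -> f ^+ k = k`!%:R * hdpow f k.
Proof.
move=> f0; elim: k => [|k IHk]; first by rewrite expr0 mul1r.
apply: hderiv_inj; first by rewrite hcoefX0 f0 expr0n hcoefM0 mulr0.
rewrite hderivX hderivM hderiv_hint hderiv_nat mul0r add0r [k.+1.-1]/= IHk.
by rewrite factS natrM -/(hdpow f k) !mulrA.
Qed.

(** The substitution \sum_k c_k f ^ k, where [c] lists ordinary, not Hurwitz, coefficients. It is
    meant for f(0) = 0: then f ^ k starts in degree k, and the sum may stop at k = n. *)
Definition hcomp c f : hurwitz R :=
  Hurwitz (fun n => \sum_(k < n.+1) c k * hcoef (f ^+ k) n).

Lemma hcoef_hcomp c f n :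
  hcoef (hcomp c f) n = \sum_(k < n.+1) c k * hcoef (f ^+ k) n.
Proof. by []. Qed.

Lemma hcomp_trunc c f N : hcoef f 0 = 0 ->
  heqmod N (hcomp c f) (\sum_(k < N) hconst (c k) * f ^+ k).
Proof.
move=> f0 n ltnN; rewrite hcoef_hcomp hcoef_sum.
under [RHS]eq_bigr => k _ do rewrite hcoef_constM.
rewrite -!(big_mkord xpredT (fun k => c k * hcoef (f ^+ k) n)).
rewrite [RHS](@big_cat_nat _ _ _ n.+1) //= [X in _ + X]big_nat [X in _ + X]big1
  ?addr0 // => k.
by case/andP=> ltnk _; rewrite (hexp_low f0 ltnk) hcoef0 mulr0.
Qed.

Lemma hcompM_trunc c f g n : hcoef f 0 = 0 ->
  hcoef (hcomp c f * g) n = \sum_(k < n.+1) c k * hcoef (f ^+ k * g) n.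
Proof.
move=> f0; rewrite (heqmodM (hcomp_trunc c (N:=n.+1) f0) (g:=g) (g':=g)) //.
by rewrite mulr_suml hcoef_sum; apply: eq_bigr => k _;
  rewrite -mulrA hcoef_constM.
Qed.

Lemma hderiv_hcomp c f : hcoef f 0 = 0 ->
  hderiv (hcomp c f) = hcomp (fun k => k.+1%:R * c k.+1) f * hderiv f.
Proof.
move=> f0; apply: hurwitzP => n; rewrite hcompM_trunc //.
rewrite -[LHS]/(hcoef (hcomp c f) n.+1) hcoef_hcomp big_ord_recl.
rewrite expr0 mulr0 add0r; apply: eq_bigr => k _; rewrite lift0.
rewrite -[hcoef (f ^+ _) _]/(hcoef (hderiv (f ^+ k.+1)) n) hderivX -mulrA.
by rewrite hcoef_natM mulrCA mulrA.
Qed.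

Lemma eq_hcomp c d f : c =1 d -> hcomp c f = hcomp d f.
Proof.
by move=> cd; apply: hurwitzP => n; rewrite !hcoef_hcomp; apply: eq_bigr => k _;
  rewrite cd.
Qed.

Lemma hcompD c d f : hcomp (fun k => c k + d k) f = hcomp c f + hcomp d f.
Proof.
apply: hurwitzP => n; rewrite hcoefD !hcoef_hcomp -big_split.
by apply: eq_bigr => k _; rewrite mulrDl.
Qed.

Lemma hcompZ a c f : hcomp (fun k => a * c k) f = hconst a * hcomp c f.
Proof.
apply: hurwitzP => n; rewrite hcoef_constM !hcoef_hcomp mulr_sumr.
by apply: eq_bigr => k _; rewrite mulrA.
Qed.

Lemma hcomp_delta f : hcoef f 0 = 0 -> hcomp (fun k => (k == 0)%:R) f = 1.
Proof.
move=> f0; apply: hderiv_inj; first by rewrite hcoef_hcomp big_ord1 mulr1.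
rewrite hderiv_hcomp // hderiv1 (eq_hcomp _ (d := fun k => 0 * 0)); last first.
  by move=> k; rewrite mulr0 mul0r.
by rewrite hcompZ hconst0 !mul0r.
Qed.

Lemma mulX_hcomp c f j : hcoef f 0 = 0 ->
  f ^+ j * hcomp c f = hcomp (fun k => if (k < j)%N then 0 else c (k - j)%N) f.
Proof.
move=> f0; apply: hurwitzP => n; rewrite mulrC hcompM_trunc // hcoef_hcomp.
under eq_bigr => k _ do rewrite -exprD.
rewrite -(big_mkord xpredT (fun k => c k * hcoef (f ^+ (k + j)) n)).
rewrite -(big_mkord xpredT (fun k => (if (k < j)%N then 0 else c (k - j)%N) *
  hcoef (f ^+ k) n)).
transitivity (\sum_(0 <= k < n.+1 + j) (if (k < j)%N then 0 else c (k - j)%N) *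
    hcoef (f ^+ k) n).
  rewrite [RHS](@big_cat_nat _ _ _ j) ?leq_addl //= [X in _ = X + _]big_nat.
  rewrite [X in _ = X + _]big1 ?add0r; last by move=> k /= ->; rewrite mul0r.
  rewrite -{2}[j]add0n big_addn addnK.
  by apply: eq_bigr => k _; rewrite ltnNge leq_addl addnK.
rewrite (@big_cat_nat _ _ _ n.+1) ?leq_addr //= [X in _ + X]big_nat.
rewrite [X in _ + X]big1 ?addr0 // => k /andP[ltnk _].
by rewrite (hexp_low f0 ltnk) hcoef0 mulr0.
Qed.

End HurwitzOps.

Arguments hvar {R}.

Section HurwitzMap.
Variables (R S : comNzRingType) (phi : {rmorphism R -> S}).

Definition hmap (f : hurwitz R) : hurwitz S :=
  Hurwitz (fun n => phi (hcoef f n)).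

Fact hmap_is_zmod_morphism : zmod_morphism hmap.
Proof. by move=> f g; apply: hurwitzP => n /=; rewrite rmorphB. Qed.

HB.instance Definition _ :=
  GRing.isZmodMorphism.Build (hurwitz R) (hurwitz S) hmap hmap_is_zmod_morphism.

Fact hmap_is_monoid_morphism : monoid_morphism hmap.
Proof.
split; first by apply: hurwitzP => -[|n] /=; rewrite ?rmorph1 ?rmorph0.
move=> f g; apply: hurwitzP => n.
elim: n f g => [|n IHn] f g; first exact: rmorphM.
rewrite hcoefMS -[hderiv (hmap f)]/(hmap (hderiv f)).
by rewrite -[hderiv (hmap g)]/(hmap (hderiv g)) -!IHn -rmorphD.
Qed.

HB.instance Definition _ :=
  GRing.isMonoidMorphism.Build (hurwitz R) (hurwitz S) hmap hmap_is_monoid_morphism.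

Lemma hderiv_hmap f : hderiv (hmap f) = hmap (hderiv f).
Proof. by []. Qed.

End HurwitzMap.

(** * The inverse function of the integral of dq / sqrt (1 - q ^ 10) *)

(* The solution of s'' = - 5 s ^ 9, s(0) = 0, s'(0) = 1, which is the inverse
   function of the integral of dq / sqrt (1 - q ^ 10). *)
Definition sine_step (f : hurwitz int) : hurwitz int :=
  Hurwitz (fun n => match n with
    | 0 => 0 | 1 => 1 | n'.+2 => - 5 * hcoef (f ^+ 9) n' end).

(** Each application of [sine_step] settles one more coefficient, so the one of index n is final
    after n + 1 iterations. *)
Definition sine : hurwitz int :=
  Hurwitz (fun n => hcoef (iter n.+1 sine_step 0) n).

Lemma sine_step_eqmod N f g : heqmod N f g ->
  heqmod N.+1 (sine_step f) (sine_step g).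
Proof.
move=> fg [|[|i]] // ltiN; congr (_ * _).
by apply: (heqmodX 9 fg); apply: ltnW.
Qed.

Lemma sine_fix : sine_step sine = sine.
Proof.
have stable N : heqmod N (iter N sine_step 0) (iter N.+1 sine_step 0).
  by elim: N => // N IHN; apply: sine_step_eqmod.
have approx N : heqmod N (iter N sine_step 0) sine.
  elim: N => // N IHN i; rewrite ltnS leq_eqVlt => /predU1P[-> //|ltiN].
  by rewrite -IHN // -stable.
apply: hurwitzP => n; rewrite -(approx n.+1) // [in RHS]iterS.
by apply: (@sine_step_eqmod n) => // i ltin; rewrite approx.
Qed.

Lemma sine0 : hcoef sine 0 = 0. Proof. by []. Qed.

Lemma sine1 : hcoef sine 1 = 1. Proof. by rewrite -sine_fix. Qed.

Lemma hderiv2_sine : hderiv (hderiv sine) = - 5%:R * sine ^+ 9.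
Proof.
apply: hurwitzP => n; rewrite mulNr hcoefN hcoef_natM -mulNr.
by rewrite -[LHS]/(hcoef sine n.+2) -{1}sine_fix.
Qed.

(** The first integral of s'' = - 5 s ^ 9: both sides have derivative - 10 s ^ 9 s'. *)
Lemma hderiv_sine_sqr : hderiv sine ^+ 2 = 1 - sine ^+ 10.
Proof.
apply: hderiv_inj;
  first by rewrite hcoefB !hcoefX0 sine0 -[hcoef (hderiv _) 0]/(hcoef sine 1)
  sine1.
rewrite hderivB hderiv1 !hderivX hderiv2_sine /=; ring.
Qed.

Section Sine.
Variable R : comNzRingType.

Definition hsine : hurwitz R := hmap (intmul 1 : {rmorphism int -> R}) sine.

Lemma hsine0 : hcoef hsine 0 = 0. Proof. by []. Qed.
Lemma hsine1 : hcoef hsine 1 = 1.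
Proof. by rewrite -[LHS]/((hcoef sine 1)%:~R) sine1. Qed.
Lemma hcosine0 : hcoef (hderiv hsine) 0 = 1. Proof. exact: hsine1. Qed.

Lemma hderiv2_hsine : hderiv (hderiv hsine) = - 5%:R * hsine ^+ 9.
Proof. by rewrite !hderiv_hmap hderiv2_sine rmorphM rmorphN rmorphXn rmorph_nat. Qed.

Lemma hderiv_hsine_sqr : hderiv hsine ^+ 2 = 1 - hsine ^+ 10.
Proof.
by rewrite hderiv_hmap -rmorphXn hderiv_sine_sqr rmorphB rmorphXn rmorph1.
Qed.

End Sine.

Arguments hsine {R}.

(* The coefficient of q ^ j in (1 - q ^ 10) ^ (- 1/2). *)
Definition invsqrt_coef (j : nat) : rat :=
  if (10 %| j)%N then 'C((j %/ 10).*2, j %/ 10)%:R / (4 ^ (j %/ 10))%:R else 0.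

Lemma central_bin_rec k :
  (k.+1 * 'C(k.+1.*2, k.+1) = 2 * (k.*2.+1 * 'C(k.*2, k)))%N.
Proof.
rewrite doubleS -mul_bin_diag -[RHS]/(2 * (k.*2.+1 * 'C(k.*2.+1.-1, k)))%N.
rewrite [in RHS]mul_bin_down -pred_Sn mulnA; congr (_ * _)%N; lia.
Qed.

Lemma invsqrt_coef0 : invsqrt_coef 0 = 1.
Proof. by []. Qed.

(** Coefficientwise form of (1 - q ^ 10) F' = 5 q ^ 9 F for F = (1 - q ^ 10) ^ (- 1/2). *)
Lemma invsqrt_coef_rec i :
  (i + 10)%:R * invsqrt_coef (i + 10) = (i + 5)%:R * invsqrt_coef i.
Proof.
rewrite /invsqrt_coef dvdn_addl //; case: ifP => [/dvdnP[k ->]|];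
  last by rewrite !mulr0.
have -> : (k * 10 + 10 = k.+1 * 10)%N by lia.
rewrite !mulnK // expnS natrM.
have k4 : (4 ^ k)%:R != 0 :> rat by rewrite pnatr_eq0 expn_eq0.
transitivity (10 / 4 * ((k.+1 * 'C(k.+1.*2, k.+1))%:R / (4 ^ k)%:R) : rat).
  by rewrite !natrM; field.
by rewrite central_bin_rec -muln2 -addn1 !(natrD, natrM); field.
Qed.

Local Notation sn := (@hsine rat).
Local Notation cn := (hderiv (@hsine rat)).

(** With F = (1 - q ^ 10) ^ (- 1/2), the derivative of F(s) s' is F'(s) (1 - s ^ 10) - 5 s ^ 9 F(s),
    which vanishes by the differential equation of F. *)
Lemma hcomp_invsqrt : hcomp invsqrt_coef sn * cn = 1.
Proof.
apply: hderiv_inj.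
  by rewrite hcoefM0 hcosine0 mulr1 hcoef_hcomp big_ord1 mulr1.
rewrite hderivM hderiv_hcomp ?hsine0 // hderiv2_hsine hderiv1 -mulrA -expr2.
rewrite hderiv_hsine_sqr mulrBr mulr1.
set c' := fun k : nat => _ * _.
have -> : hcomp c' sn * sn ^+ 10 =
  sn ^+ 9 * (hcomp (fun k => k%:R * invsqrt_coef k) sn).
  rewrite [in RHS](@eq_hcomp _ _ (fun k => if (k < 1)%N then 0 else c' (k - 1)%N)); last first.
    by case=> [|k]; rewrite ?mul0r //= subn1.
  by rewrite -mulX_hcomp ?hsine0 // [RHS]mulrA -exprD mulrC.
have -> : hcomp c' sn =
  sn ^+ 9 * hcomp (fun k => (k + 5)%:R * invsqrt_coef k) sn.
  rewrite mulX_hcomp ?hsine0 //; apply: eq_hcomp => k.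
  case: ltnP => [ltk9|le9k].
    by rewrite /c' /invsqrt_coef; case: ifP => [/dvdnP[j]|];
      [lia | rewrite mulr0].
  rewrite /c' -invsqrt_coef_rec.
  by have -> : (k - 9 + 10 = k.+1)%N by lia.
rewrite (@eq_hcomp _ _ (fun k => k%:R * invsqrt_coef k + 5%:R * invsqrt_coef k)); last first.
  by move=> k; rewrite natrD mulrDl.
rewrite hcompD hcompZ.
have -> : hconst (5%:R : rat) = 5%:R by apply: hurwitzP => -[|n];
  rewrite ?hcoefMn //= ?mul0rn.
ring.
Qed.

(** * The expansions of x and y in terms of s *)

(** This is u / s, from u = \sum_j c_j s ^ (j + 1) / (j + 1). Powers of 1 / s become powers of this
    series over powers of u, so no inverse is ever formed. *)
Definition arcsine_quot : hurwitz rat :=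
  hcomp (fun j => invsqrt_coef j / j.+1%:R) sn.

Lemma hsineM_arcsine_quot : sn * arcsine_quot = hvar.
Proof.
apply: hderiv_inj; first by rewrite hcoefM0 mul0r.
rewrite hderiv_hint -[X in hderiv (X * _)]expr1 mulX_hcomp ?hsine0 //.
rewrite hderiv_hcomp ?hsine0 // -hcomp_invsqrt; congr (_ * _).
by apply: eq_hcomp => k /=; rewrite subn1 /= mulrC divfK // pnatr_eq0.
Qed.

Lemma arcsine_quot0 : hcoef arcsine_quot 0 = 1.
Proof. by rewrite hcoef_hcomp big_ord1 mulr1. Qed.

(** Let q = u / s. Differentiating s q = u gives s q' = 1 - s' q; multiplication by q turns the left
    side into u q'. *)
Lemma heuler_arcsine_quot : heuler arcsine_quot =
  arcsine_quot - cn * arcsine_quot ^+ 2.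
Proof.
have /(congr1 (@hderiv rat)) := hsineM_arcsine_quot.
rewrite hderiv_hint hderivM => D1.
transitivity (arcsine_quot * (1 - cn * arcsine_quot)); last by ring.
by rewrite /heuler -hsineM_arcsine_quot -D1; ring.
Qed.

Lemma heulerM (f g : hurwitz rat) : heuler (f * g) =
  heuler f * g + f * heuler g.
Proof. by rewrite /heuler hderivM; ring. Qed.

(** This is u ^ 2 x for x = 1 / s ^ 2. *)
Definition xnum : hurwitz rat := arcsine_quot ^+ 2.

Lemma xnum0 : hcoef xnum 0 = 1.
Proof. by rewrite hcoefX0 arcsine_quot0 expr1n. Qed.

(** The left side is u ^ 3 x', because u (u ^ 2 x)' = 2 u ^ 2 x + u ^ 3 x'. *)
Lemma heuler_xnum : heuler xnum - 2%:R * xnum =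
  - 2%:R * (cn * arcsine_quot ^+ 3).
Proof.
rewrite /xnum expr2 heulerM heuler_arcsine_quot; ring.
Qed.

(** The equation x ^ 2 x' ^ 2 = 4 x ^ 5 - 4, multiplied by u ^ 10. *)
Lemma xnum_eq :
  xnum ^+ 2 * (heuler xnum - 2%:R * xnum) ^+ 2 =
    4%:R * (xnum ^+ 5 - hvar ^+ 10).
Proof.
rewrite heuler_xnum -hsineM_arcsine_quot.
transitivity (4%:R * cn ^+ 2 * arcsine_quot ^+ 10);
  first by rewrite /xnum; ring.
by rewrite hderiv_hsine_sqr /xnum; ring.
Qed.

(** This is u ^ 5 y for y = - s' / s ^ 5. *)
Definition ynum : hurwitz rat := - (cn * arcsine_quot ^+ 5).

Lemma ynumE : 2%:R * ynum = xnum * (heuler xnum - 2%:R * xnum).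
Proof. by rewrite heuler_xnum /ynum /xnum; ring. Qed.

Lemma heulerB (f g : hurwitz rat) : heuler (f - g) = heuler f - heuler g.
Proof. by rewrite /heuler hderivB; ring. Qed.

Lemma heulerD (f g : hurwitz rat) : heuler (f + g) = heuler f + heuler g.
Proof. by rewrite /heuler hderivD; ring. Qed.

Lemma heuler_natM n (f : hurwitz rat) : heuler (n%:R * f) = n%:R * heuler f.
Proof. by rewrite /heuler hderivM hderiv_nat; ring. Qed.

(* This is x''' = 24 y + 24 s ^ 5 s' with the poles cleared. *)
Lemma ynum_of_xnum :
  let f := heuler xnum - 2%:R * xnum in
  let g := heuler f - 3%:R * f in
  24%:R * ynum = heuler g - 4%:R * g - 24%:R * (hvar ^+ 5 * (sn ^+ 5 * cn)).
Proof.
move=> f g.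
(* Here g is u ^ 4 x'', and x'' = 6 / s ^ 4 + 4 s ^ 6 by s' ^ 2 = 1 - s ^ 10. *)
have eg : g = 6%:R * arcsine_quot ^+ 4 + 4%:R * (sn ^+ 6 * hvar ^+ 4).
  have heuler_cn : heuler cn = - 5%:R * sn ^+ 9 * hvar.
    by rewrite /heuler hderiv2_hsine; ring.
  have heuler_X3 : heuler (arcsine_quot ^+ 3) =
      3%:R * arcsine_quot ^+ 2 * (arcsine_quot - cn * arcsine_quot ^+ 2).
    by rewrite -heuler_arcsine_quot /heuler hderivX /=; ring.
  rewrite /g /f heuler_xnum mulNr -mulrN heuler_natM.
  rewrite -(mulN1r (cn * _)) heulerM heulerM heuler_cn heuler_X3.
  have -> : heuler (- 1) = 0 :> hurwitz rat.
    by rewrite /heuler hderivN hderiv1 oppr0 mulr0.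
  rewrite -hsineM_arcsine_quot.
  transitivity (6%:R * cn ^+ 2 * arcsine_quot ^+ 4 +
                10%:R * (sn ^+ 10 * arcsine_quot ^+ 4)); first by ring.
  rewrite hderiv_hsine_sqr; ring.
rewrite eg heulerD !heuler_natM (heulerM (sn ^+ 6)).
have heulerX (h : hurwitz rat) k : heuler (h ^+ k) =
  k%:R * h ^+ k.-1 * heuler h.
  by rewrite /heuler hderivX; ring.
rewrite !heulerX heuler_arcsine_quot /heuler hderiv_hint /ynum
  -hsineM_arcsine_quot /=.
ring.
Qed.

(* V / u is the primitive of x without constant term. *)
Lemma xnum_primitive :
  let V := hvar * hcomp (fun i => invsqrt_coef i.+1 / i%:R) sn - arcsine_quot in
  heuler V - V = xnum.
Proof.
(* W is the antiderivative in q of ((1 - q ^ 10) ^ (- 1/2) - 1) / q ^ 2, taken at q = s; its term i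
   = 0 is 0. The subtracted 1 / q ^ 2 integrates to - 1 / s, which accounts for - [arcsine_quot] in
   V. *)
move=> V; pose W := hcomp (fun i => invsqrt_coef i.+1 / i%:R) sn.
have DW : sn ^+ 2 * hderiv W = 1 - cn.
  rewrite hderiv_hcomp ?hsine0 // mulrA mulX_hcomp ?hsine0 //.
  rewrite -[X in _ = X - _]hcomp_invsqrt -[X in _ = _ - X]mul1r -mulrBl.
  congr (_ * _); rewrite -(@hcomp_delta _ sn) // -mulN1r -[-1]/(- hconst 1).
  have -> : - hconst 1 = hconst (-1) :> hurwitz rat.
    by apply: hurwitzP => -[|n] //=; rewrite oppr0.
  rewrite -hcompZ -hcompD; apply: eq_hcomp => -[|[|k]] /=.
    - by rewrite mulr1 invsqrt_coef0 subrr.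
    - by rewrite mulr0 addr0.
  by rewrite mulr0 addr0 subn2 /= mulrC divfK // pnatr_eq0.
rewrite /V -/W heulerB heulerM heuler_arcsine_quot /xnum.
rewrite /heuler hderiv_hint.
transitivity (hvar ^+ 2 * hderiv W + cn * arcsine_quot ^+ 2); first by ring.
rewrite -hsineM_arcsine_quot exprMn mulrAC DW; ring.
Qed.

(** The operator u d/du - 1 multiplies the coefficient of index m + 1 by m. The second sum carries
    the denominators j + 1 that survive in the end. *)
Lemma hcoef_xnum m :
  hcoef xnum m.+1 = m%:R *
    (m.+1%:R * \sum_(i < m.+1) invsqrt_coef i.+1 / i%:R * hcoef (sn ^+ i) m
     - \sum_(j < m.+2) invsqrt_coef j / j.+1%:R * hcoef (sn ^+ j) m.+1).
Proof.
rewrite -xnum_primitive hcoefB hcoef_heuler hcoefB hcoef_hvarMS.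
rewrite !hcoef_hcomp -natr1; ring.
Qed.

Lemma hcoef_hvarX j (f : hurwitz rat) n :
  hcoef (hvar ^+ j * f) (n + j) = ((n + j) ^_ j)%:R * hcoef f n.
Proof.
elim: j => [|j IHj]; first by rewrite addn0 mul1r ffactn0 mul1r.
by rewrite exprS -mulrA addnS hcoef_hvarMS IHj ffactSS natrM mulrA.
Qed.

(** On index m + 5 the three Euler operators, shifted by 2, 3 and 4, act as m + 3, m + 2 and m +
    1. *)
Lemma hcoef_ynum m :
  24%:R * hcoef ynum (m + 5) =
  (m + 3)%:R * (m + 2)%:R * (m + 1)%:R * hcoef xnum (m + 5)
  - 24%:R * (((m + 5) ^_ 5)%:R * hcoef (sn ^+ 5 * cn) m).
Proof.
have /(congr1 (fun f => hcoef f (m + 5))) := ynum_of_xnum; cbv zeta.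
rewrite hcoef_natM !hcoefB !hcoef_natM !(hcoef_heuler, hcoefB, hcoef_natM)
  hcoef_hvarX.
by move=> ->; rewrite !natrD; ring.
Qed.

(** * Laurent series and Hurwitz series *)

Lemma hvarX_low (R : comNzRingType) j (f : hurwitz R) n :
  (n < j)%N -> hcoef (hvar ^+ j * f) n = 0.
Proof.
move=> ltnj; rewrite (@heqmodM _ j _ 0 f f (hexp_low (f := hvar) _)) //.
by rewrite mul0r hcoef0.
Qed.

Lemma ffact_rat_neq0 n j : ((n + j) ^_ j)%:R != 0 :> rat.
Proof. by rewrite pnatr_eq0 -lt0n ffact_gt0 leq_addl. Qed.

Lemma ffact_addl_fact n j : ((n + j) ^_ j * n`!)%N = (n + j)`!.
Proof. by rewrite -[in n`!](addnK j n) ffact_fact // leq_addl. Qed.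

Lemma hvarXI j (f g : hurwitz rat) : hvar ^+ j * f = hvar ^+ j * g -> f = g.
Proof.
move=> eqfg; apply: hurwitzP => n.
have : hcoef (hvar ^+ j * f) (n + j) =
  hcoef (hvar ^+ j * g) (n + j) by rewrite eqfg.
by rewrite !hcoef_hvarX => /(mulfI (ffact_rat_neq0 n j)).
Qed.

Lemma hvarX_factor j (f : hurwitz rat) : heqmod j f 0 ->
  f = hvar ^+ j * Hurwitz (fun n => hcoef f (n + j) / ((n + j) ^_ j)%:R).
Proof.
move=> f_low; apply: hurwitzP => n; have [ltnj|lejn] := ltnP n j.
  by rewrite f_low // hvarX_low // hcoef0.
by rewrite -(subnK lejn) hcoef_hvarX mulrC divfK ?ffact_rat_neq0.
Qed.

Definition egf (a : nat -> rat) : hurwitz rat :=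
  Hurwitz (fun n => a n * n`!%:R).

Lemma egfM a b : egf a * egf b =
  egf (fun n => \sum_(i < n.+1) a i * b (n - i)%N).
Proof.
have egf_deriv c : hderiv (egf c) = egf (fun n => n.+1%:R * c n.+1).
  by apply: hurwitzP => n; rewrite /= factS natrM; ring.
apply: hurwitzP => n; elim: n a b => [|n IHn] a b.
  by rewrite /= big_ord1 fact0 !mulr1.
rewrite hcoefMS !egf_deriv !IHn /= -mulrDl factS natrM mulrA; congr (_ * _).
rewrite big_distrl /=.
(* The factor n + 1 is split as i + (n + 1 - i), one part for the derivative of each factor. *)
transitivity (\sum_(i < n.+2) (i%:R * a i * b (n.+1 - i)%N + 
                               (n.+1 - i)%:R * a i * b (n.+1 - i)%N)); last first.
  apply: eq_bigr => i _; rewrite natrB ?(leq_ord i) //; ring.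
rewrite big_split /=; congr (_ + _).
  by rewrite [RHS]big_ord_recl !mul0r add0r; apply: eq_bigr => i _;
    rewrite lift0 subSS.
rewrite [RHS]big_ord_recr /= subnn !mul0r addr0; apply: eq_bigr => i _.
by rewrite (subSn (leq_ord i)); ring.
Qed.

Section LaurentNumerator.
Implicit Types (f g : laurent rat) (N M : nat).

(* u ^ N times f, as a Hurwitz series; the terms of f below u ^ - N are lost. *)
Definition lnum N f : hurwitz rat := egf (fun n => lcoef f (n%:Z - N%:Z)).

Lemma eq_lnum N f g : leq_series f g -> lnum N f = lnum N g.
Proof. by move=> fg; apply: hurwitzP => n; rewrite /= fg. Qed.

Lemma lnumE N k f : lmin f = k%:Z - N%:Z -> lnum N f = hvar ^+ k * egf (lseq f).
Proof.
move=> lminf; apply: hurwitzP => n; have [ltnk|lekn] := ltnP n k.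
  rewrite hvarX_low //= /lcoef lminf.
  by case: ifP => [|_]; rewrite ?mul0r // => ?; lia.
rewrite -(subnK lekn) hcoef_hvarX /= mulrCA -natrM ffact_addl_fact.
congr (_ * _); rewrite /lcoef lminf; case: ifP => [_|]; last by lia.
by congr (lseq f _); lia.
Qed.

(** The bound on [lmin f] ensures that [lnum N f] has dropped no term of [f]. *)
Lemma lnum_shift N j f : - N%:Z <= lmin f ->
  lnum (j + N) f = hvar ^+ j * lnum N f.
Proof.
move=> leNf; rewrite (@lnumE (j + N) (j + `|lmin f + N|)); last by lia.
by rewrite (@lnumE N `|lmin f + N|) ?exprD ?mulrA //; lia.
Qed.

Lemma lnumM N M f g : - N%:Z <= lmin f -> - M%:Z <= lmin g ->
  lnum (N + M) (lmul f g) = lnum N f * lnum M g.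
Proof.
move=> leNf leMg.
rewrite (@lnumE N `|lmin f + N|); last by lia.
rewrite (@lnumE M `|lmin g + M|); last by lia.
rewrite mulrACA egfM -exprD; apply: lnumE => /=; lia.
Qed.

Lemma lmin_exp f n : lmin (lexp f n) = n%:Z * lmin f.
Proof.
elim: n => [|n IHn]; first by rewrite mul0r.
rewrite -[lmin _]/(lmin f + lmin (lexp f n)) IHn; lia.
Qed.

Lemma lnum_const N c : lnum N (lconst c) = hvar ^+ N * hconst c.
Proof.
rewrite (@lnumE _ N) /= ?subrr //; congr (_ * _).
by apply: hurwitzP => -[|n] /=; rewrite ?mulr1 ?mul0r.
Qed.

Lemma lnumX N f n : - N%:Z <= lmin f -> lnum (n * N) (lexp f n) = lnum N f ^+ n.
Proof.
move=> leNf; elim: n => [|n IHn]; first by rewrite lnum_const mul1r.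
rewrite mulSn exprS -IHn; apply: lnumM => //.
by rewrite lmin_exp PoszM -mulrN; apply: ler_wpM2l.
Qed.

Lemma lcoef_lsub f g m : lcoef (lsub f g) m = lcoef f m - lcoef g m.
Proof.
rewrite {1}/lcoef /=; case: ifP => [lem|].
  by have -> : Order.min (lmin f) (lmin g) +
    `|(m - Order.min (lmin f) (lmin g))%R|%N%:Z = m by lia.
by rewrite /lcoef ge_min; do 2!case: ifP => //=; rewrite subrr.
Qed.

Lemma lnumB N f g : lnum N (lsub f g) = lnum N f - lnum N g.
Proof. by apply: hurwitzP => n; rewrite /= lcoef_lsub mulrBl. Qed.

Lemma lcoef_lderiv f (m : int) : lcoef (lderiv f) (m - 1) = m%:~R * lcoef f m.
Proof.
rewrite /lcoef /= lerD2r; case: ifP => [lem|]; last by rewrite mulr0.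
have -> : absz (m - 1 - (lmin f - 1))%R = absz (m - lmin f)%R by congr absz;
  lia.
by have -> : lmin f + `|(m - lmin f)%R|%N%:Z = m by lia.
Qed.

Lemma lnum_deriv N f :
  lnum N.+1 (lderiv f) = heuler (lnum N f) - N%:R * lnum N f.
Proof.
apply: hurwitzP => n; rewrite hcoefB hcoef_heuler hcoef_natM /=.
have -> : n%:Z - N.+1%:Z = n%:Z - N%:Z - 1 by lia.
by rewrite lcoef_lderiv rmorphB /=; ring.
Qed.

Lemma lnum_var : lnum 0 (lvar rat) = hvar.
Proof.
rewrite (@lnumE _ 1) //= -[RHS]mulr1; congr (_ * _).
by apply: hurwitzP => -[|n] /=; rewrite ?mulr1 ?mul0r.
Qed.

Lemma lcoef_lnum k j f h m :
  lnum (k + j) f = hvar ^+ k * h -> lcoef f (m%:Z - j%:Z) = hcoef h m / m`!%:R.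
Proof.
move=> /(congr1 (fun h => hcoef h (m + k))); rewrite hcoef_hvarX /=.
have -> : (m + k)%N%:Z - (k + j)%N%:Z = m%:Z - j%:Z by lia.
rewrite -ffact_addl_fact natrM mulrCA => /(mulfI (ffact_rat_neq0 m k)) <-.
by rewrite mulfK // pnatr_eq0 -lt0n fact_gt0.
Qed.

End LaurentNumerator.

(** The difference d of two solutions satisfies a linear equation d G1 + (u d' - 2 d) G2 = 0 with
    G1(0) = - 12 and G2(0) = - 4. If d vanishes below index n, its coefficient there is multiplied
    by - 12 - 4 (n - 2) = - (4 + 4 n), hence is 0. *)
Lemma xnum_unique (X : hurwitz rat) : hcoef X 0 = 1 ->
  X ^+ 2 * (heuler X - 2%:R * X) ^+ 2 = 4%:R * (X ^+ 5 - hvar ^+ 10) ->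
    X = xnum.
Proof.
move=> X0 eqX.
have [aX aXE] : exists f, f = heuler X - 2%:R * X by eexists.
have [aZ aZE] : exists f, f = heuler xnum - 2%:R * xnum by eexists.
pose G1 := (X + xnum) * aX ^+ 2 - 4%:R * (X ^+ 4 + X ^+ 3 * xnum +
  X ^+ 2 * xnum ^+ 2 + X * xnum ^+ 3 + xnum ^+ 4).
pose G2 := xnum ^+ 2 * (aX + aZ).
pose d := X - xnum.
have eqd : d * G1 + (heuler d - 2%:R * d) * G2 = 0.
  rewrite /d heulerB.
  transitivity ((X ^+ 2 * aX ^+ 2 - 4%:R * (X ^+ 5 - hvar ^+ 10)) -
    (xnum ^+ 2 * aZ ^+ 2 - 4%:R * (xnum ^+ 5 - hvar ^+ 10))).
    by rewrite /G1 /G2 aXE aZE; ring.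
  by rewrite aXE aZE eqX xnum_eq !subrr.
have aX0 : hcoef aX 0 = - 2 by rewrite aXE hcoefB hcoef_heuler hcoef_natM X0;
  ring.
have aZ0 : hcoef aZ 0 = - 2 by rewrite aZE hcoefB hcoef_heuler hcoef_natM xnum0;
  ring.
have G10 : hcoef G1 0 = - 12.
  rewrite /G1 hcoefB hcoefM0 hcoef_natM !(hcoefD, hcoefX0, hcoefM0).
  by rewrite X0 ?xnum0 ?arcsine_quot0 aX0; ring.
have G20 : hcoef G2 0 = - 4.
  by rewrite /G2 hcoefM0 hcoefX0 hcoefD ?xnum0 ?arcsine_quot0 aX0 aZ0; ring.
clearbody G1 G2; suff d_low n : heqmod n d 0.
  by apply/eqP; rewrite -subr_eq0; apply/eqP/hurwitzP => n; apply: (d_low n.+1).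
elim: n => // n IHn i; rewrite ltnS leq_eqVlt => /predU1P[->|]; last exact: IHn.
case: n IHn => [|n] IHn; first by rewrite hcoefB X0 xnum0 subrr.
have := congr1 (fun f => hcoef f n.+1) eqd; rewrite hcoefD !hcoefM_low //;
  last first.
  by move=> j ltjn; rewrite hcoefB hcoef_heuler hcoef_natM IHn // !hcoef0; ring.
rewrite G10 G20 hcoefB hcoef_heuler hcoef_natM !hcoef0 => dn0.
apply: (mulfI (x := - (4 + 4 * n.+1%:R))).
  rewrite oppr_eq0; have -> : 4 + 4 * n.+1%:R = (4 + 4 * n.+1)%:R :> rat.
    by rewrite natrD natrM.
  by rewrite pnatr_eq0.
by rewrite mulr0 -[RHS]dn0; ring.
Qed.

(** Comparing orders at u = 0 forces x to have a double pole with leading coefficient 1, after which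
    [xnum_unique] identifies x; then 2 y = x x' gives y. *)
Lemma expansion_num (x y : laurent rat) : expansion_at_infinity x y ->
  forall m, lcoef x (m%:Z - 2) = hcoef xnum m / m`!%:R /\
            lcoef y (m%:Z - 5) = hcoef ynum m / m`!%:R.
Proof.
case=> eqy [m0 m0_lt0 xm0] eqdu.
pose N := (`|lmin x| + `|lmin y|)%N.
have leNx : - N%:Z <= lmin x by rewrite /N; lia.
have leNy : - N%:Z <= lmin y by rewrite /N; lia.
pose x1 := lnum N x; pose y1 := lnum N y.
(* The curve equation times u ^ (5 N); next comes the differential relation times u ^ (2 N + 1). *)
have eq1 : hvar ^+ (3 * N) * y1 ^+ 2 = x1 ^+ 5 - hvar ^+ (5 * N).
  have := eq_lnum (5 * N) eqy; rewrite lnumB lnumX // lnum_const mulr1.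
  have -> : (5 * N = 3 * N + 2 * N)%N by lia.
  by rewrite lnum_shift ?lnumX // lmin_exp; lia.
have eq2 : hvar ^+ N.+1 * (2%:R * y1) = x1 * (heuler x1 - N%:R * x1).
  have := eq_lnum (N + N.+1) eqdu; rewrite (lnumM (f := x) (M := N.+1)) //;
    last by rewrite /=; lia.
  rewrite lnum_deriv => <-.
  rewrite [(N + _)%N](_ : _ = N + ((0 + N) + 1))%N; last by lia.
  rewrite lnum_shift /=; last by lia.
  rewrite !lnumM //=; last by lia.
  rewrite lnum_const lnum_deriv lnum_var /heuler hderiv_hint.
  have -> : hconst 2 = 2%:R :> hurwitz rat by apply: hurwitzP => -[|n];
    rewrite hcoefMn.
  by rewrite exprSr -/y1; ring.
have [k1 ltk1N x1k1] : exists2 k1, (k1 < N)%N & hcoef x1 k1 != 0.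
  have : lmin x <= m0 by move: xm0; rewrite /lcoef; case: ifP; rewrite ?eqxx.
  move=> lem0; exists (absz (m0 + N%:Z)%R); first by lia.
  rewrite /= mulf_neq0 ?pnatr_eq0 -?lt0n ?fact_gt0 //.
  by have -> : (absz (m0 + N%:Z)%R)%:Z - N%:Z = m0 by lia.
(* The order of u ^ N x is k, so v = N - k is the order of the pole of x, positive by [has_pole]. *)
have /ex_minnP[k x1k kmin] : exists k, hcoef x1 k != 0 by exists k1.
have [v v_gt0 Nkv] : exists2 v, (0 < v)%N & N = (k + v)%N.
  by have := kmin _ x1k1; exists (N - k)%N; lia.
have [X x1E] : exists X, x1 = hvar ^+ k * X.
  have x1_low : heqmod k x1 0.
    move=> i ltik; rewrite hcoef0; apply/eqP; apply: contraTT ltik.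
    by rewrite -leqNgt; apply: kmin.
  by eexists; apply: hvarX_factor.
have X0 : hcoef X 0 != 0.
  move: x1k; rewrite x1E -[k in hcoef _ k]add0n hcoef_hvarX.
  by apply: contraNneq => ->; rewrite mulr0.
have [aX aXE] : exists f, f = heuler X - v%:R * X by eexists.
have aX0 : hcoef aX 0 = - v%:R * hcoef X 0.
  by rewrite aXE hcoefB hcoef_heuler hcoef_natM; ring.
have {}eq2 : hvar ^+ v.+1 * (2%:R * y1) = hvar ^+ k * (X * aX).
  apply: (@hvarXI k); rewrite mulrA -exprD addnS -Nkv eq2 x1E aXE /heuler.
  by rewrite Nkv natrD hderivM hderivX hderiv_hint; case: (k) => [|j] /=;
    rewrite ?exprS; ring.
(* Elimination of y: x = X / u ^ v and x' = aX / u ^ (v + 1) in x ^ 2 x' ^ 2 = 4 x ^ 5 - 4, with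
   poles cleared. *)
have eqv : hvar ^+ v * (X * aX) ^+ 2 =
  hvar ^+ 2 * (4%:R * (X ^+ 5 - hvar ^+ (5 * v))).
  apply: (@hvarXI (5 * k + 2 * v)).
  have hvarX_mul i j : (hvar : hurwitz rat) ^+ (i * j) = (hvar ^+ j) ^+ i.
    by rewrite mulnC exprM.
  transitivity (hvar ^+ (3 * N) * (hvar ^+ k * (X * aX)) ^+ 2).
    by rewrite Nkv (exprD _ (5 * k)) !hvarX_mul (exprD hvar k v); ring.
  rewrite -eq2; transitivity (4%:R * (hvar ^+ v * hvar) ^+ 2 *
      (hvar ^+ (3 * N) * y1 ^+ 2)); first by rewrite (exprS hvar v); ring.
  by rewrite eq1 x1E Nkv (exprD _ (5 * k)) !hvarX_mul (exprD hvar k v); ring.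
(* For v = 1 the constant term of X aX would vanish, for v > 2 that of X ^ 5; neither does. *)
have v2 : v = 2%N.
  case: v v_gt0 Nkv aXE aX0 eq2 eqv => [|[|[|v]]] // _ Nkv aXE aX0 eq2 eqv.
    have /(congr1 (fun h => hcoef h 0)) : (X * aX) ^+ 2 =
        hvar * (4%:R * (X ^+ 5 - hvar ^+ 5)).
      by apply: (@hvarXI 1); rewrite eqv; ring.
    rewrite hcoefX0 !hcoefM0 mul0r aX0 => /eqP.
    by rewrite expf_eq0 /= !mulf_eq0 oppr_eq0 oner_eq0 /= (negPf X0).
  have /(congr1 (fun h => hcoef h 0)) : hvar * (hvar ^+ v * (X * aX) ^+ 2) =
      4%:R * (X ^+ 5 - hvar ^+ (5 * v.+3)).
    by apply: (@hvarXI 2); rewrite -eqv -(addn3 v) (exprD hvar v 3); ring.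
  rewrite hcoefM0 mul0r hcoef_natM hcoefB !hcoefX0 -[hcoef hvar 0]/0 expr0n
    subr0.
  by move/esym/eqP; rewrite mulf_eq0 expf_eq0 /= (negPf X0).
subst v.
have {}eqv : (X * aX) ^+ 2 = 4%:R * (X ^+ 5 - hvar ^+ 10).
  exact: (@hvarXI 2).
(* For a = X(0), constant terms give 4 a ^ 4 = 4 a ^ 5. *)
have X1 : hcoef X 0 = 1.
  have /(congr1 (fun h => hcoef h 0)) := eqv.
  rewrite hcoef_natM hcoefB !hcoefX0 hcoefM0 aX0 -[hcoef hvar 0]/0 expr0n subr0.
  set a := hcoef X 0 in X0 * => eqa; apply/eqP; rewrite -subr_eq0.
  have : 4%:R * a ^+ 4 * (a - 1) =
    0 by rewrite -[RHS](subrr (4%:R * a ^+ 5)) -{2}eqa; ring.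
  by move/eqP; rewrite mulf_eq0 => /orP[|//];
    rewrite mulf_eq0 expf_eq0 /= (negPf X0).
have XE : X = xnum by apply: xnum_unique => //; rewrite -aXE -exprMn.
move=> m; split; first by apply: (@lcoef_lnum k 2); rewrite -Nkv -/x1 x1E XE.
apply: (@lcoef_lnum k 5); have -> : (k + 5 = 3 + N)%N by lia.
rewrite lnum_shift // -/y1.
have {eq2} : 2%:R * (hvar ^+ 3 * y1) = 2%:R * (hvar ^+ k * ynum).
  rewrite mulrCA eq2 [RHS]mulrCA ynumE aXE XE //.
move=> eq2; apply: hurwitzP => n.
have := congr1 (fun h => hcoef h n) eq2; rewrite !hcoef_natM.
by apply: mulfI.
Qed.

(** * Reduction modulo p *)

Section CharP.
Variables (R : comNzRingType) (p : nat).
Hypothesis pcharRp : p \in [pchar R].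
Implicit Types f g : hurwitz R.

Let p_prime : prime p. Proof. exact: pcharf_prime pcharRp. Qed.

Lemma pchar_hurwitz : p \in [pchar (hurwitz R)].
Proof.
apply/andP; split=> //; apply/eqP/hurwitzP => n.
by rewrite hcoefMn (mulrn_pchar pcharRp) hcoef0.
Qed.

(** The derivative p f ^ (p - 1) f' is 0, and a Hurwitz series with zero derivative is constant,
    even in characteristic p. *)
Lemma hexp_pchar f : f ^+ p = hconst (hcoef f 0 ^+ p).
Proof.
rewrite [LHS]hderiv_eq0 ?hcoefX0 // hderivX.
by rewrite (pcharf0 pchar_hurwitz) !mul0r.
Qed.

(** In the Leibniz formula all inner binomial coefficients are divisible by p, so D ^ p is again a
    derivation. *)
Lemma iter_hderivM_pchar f g :
  iter p (@hderiv R) (f * g) =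
    iter p (@hderiv R) f * g + f * iter p (@hderiv R) g.
Proof.
rewrite iter_hderivM big_ord_recl bin0 mul1r subn0 [RHS]addrC; congr (_ + _).
have binp0 i : (0 < i < p)%N -> 'C(p, i)%:R = 0 :> hurwitz R.
  move=> ltip; apply/eqP; rewrite -(dvdn_pcharf pchar_hurwitz).
  exact: prime_dvd_bin.
have := prime_gt0 p_prime; case: (p) binp0 => [|q] // binp0 _.
rewrite big_ord_recr big1 => [|i _].
  by rewrite [LHS]add0r /= /bump /= add1n binn subnn mul1r.
by rewrite binp0 ?mul0r //= /bump /= add1n ltnS ltn_ord.
Qed.

Lemma iter_hderivX_pchar f j :
  iter p (@hderiv R) (f ^+ j) = j%:R * f ^+ j.-1 * iter p (@hderiv R) f.
Proof.
elim: j => [|j IHj].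
  rewrite expr0 !mul0r; have := prime_gt0 p_prime; case: (p) => // q _.
  by rewrite iterSr hderiv1; elim: q => //= q ->; rewrite hderiv0.
rewrite exprS iter_hderivM_pchar IHj /=; case: j {IHj} => [|j] /=;
  first by rewrite !expr0; ring.
by rewrite -!natr1 exprS; ring.
Qed.

End CharP.

(** * The function s modulo a prime p = 10 k + 1 *)

Section SineModP.
Variables (K : fieldType) (p k : nat).
Hypothesis (pcharKp : p \in [pchar K]) (pk : p = (10 * k).+1).

Let p_prime : prime p. Proof. exact: pcharf_prime pcharKp. Qed.
Let k_gt0 : (0 < k)%N.
Proof. by have := prime_gt1 p_prime; rewrite pk; case: (k). Qed.

Notation sn := (@hsine K).
Notation cn := (hderiv (@hsine K)).
Notation h := (hcoef sn p).

Lemma hcosine_pchar : cn ^+ p = 1.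
Proof. by rewrite (hexp_pchar pcharKp) hcosine0 expr1n. Qed.

Lemma hsine_pchar j : (p <= j)%N -> sn ^+ j = 0.
Proof.
move=> lepj; rewrite -(subnK lepj) exprD (hexp_pchar pcharKp) hsine0.
by rewrite expr0n; case: (p) (prime_gt0 p_prime) => // q _; rewrite mulr0.
Qed.

(* The derivations D ^ p and D both respect the relation between s and s', so
   they are proportional on s; the factor is constant because they commute. *)
Lemma iter_hderiv_hsine : iter p (@hderiv K) sn = hconst h * cn.
Proof.
set g := iter p _ sn.
have g0 : hcoef g 0 = h by rewrite /g hcoef_iter_deriv.
have Dg : iter p (@hderiv K) cn = hderiv g by rewrite /g -iterSr -iterS.
have two0 : (2 : K) != 0.
  rewrite -(dvdn_pcharf pcharKp); apply/negP => /dvdn_leq.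
  by rewrite pk => /(_ isT); lia.
(* Apply D ^ p to s' ^ 2 = 1 - s ^ 10: the result is 2 s' g' = - 10 s ^ 9 g = 2 s'' g. *)
have wronsk : cn * hderiv g = hderiv cn * g.
  have := congr1 (iter p (@hderiv K)) (hderiv_hsine_sqr K).
  rewrite (iter_hderivX_pchar pcharKp) Dg.
  have -> : 1 - sn ^+ 10 = 1 + (- 1) * sn ^+ 10 by ring.
  rewrite iter_hderivD (iter_hderivM_pchar pcharKp) (iter_hderivX_pchar pcharKp)
    -/g.
  have it0 f : hderiv f = 0 -> iter p (@hderiv K) f = 0.
    move=> f0; case: (p) (prime_gt0 p_prime) => // q _.
    by rewrite iterSr f0; elim: q => //= q ->; rewrite hderiv0.
  rewrite (it0 1) ?hderiv1 // (it0 (- 1)) ?hderivN ?hderiv1 ?oppr0 //= => e.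
  apply: hurwitzP => n; apply: (mulfI two0).
  rewrite -!hcoef_natM hderiv2_hsine.
  by congr (hcoef _ n); rewrite mulrA -[X in X * _]/(2%:R * cn ^+ 1) e; ring.
have [q pq] : exists q, p = q.+2 by exists (p - 2)%N; rewrite pk; lia.
(* Since s' ^ p = 1, the factor s' ^ (p - 1) is 1 / s'; so g / s' is shown to be constant. *)
have w0 : hderiv (g * cn ^+ q.+1) = 0.
  have pH0 : q.+1%:R = - 1 :> hurwitz K.
    apply/eqP; rewrite -subr_eq0 opprK natr1 -pq.
    by rewrite (pcharf0 (pchar_hurwitz pcharKp)).
  rewrite hderivM hderivX pH0 /=.
  transitivity (cn ^+ q * (cn * hderiv g - hderiv cn * g));
    first by rewrite exprS; ring.
  by rewrite wronsk subrr mulr0.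
rewrite -[g]mulr1 -hcosine_pchar pq exprSr mulrA (hderiv_eq0 w0).
by rewrite hcoefM0 hcoefX0 hcosine0 expr1n mulr1 g0 pq.
Qed.

Lemma iter_hderiv_hsineX j :
  iter p (@hderiv K) (sn ^+ j) = hconst h * hderiv (sn ^+ j).
Proof.
by rewrite (iter_hderivX_pchar pcharKp) iter_hderiv_hsine hderivX; ring.
Qed.

Lemma Wilson_pchar : (p.-1)`!%:R = -1 :> K.
Proof.
apply/eqP; rewrite -subr_eq0 opprK natr1 -(dvdn_pcharf pcharKp).
by rewrite -Wilson ?prime_gt1.
Qed.

Lemma hcoef_hsineX_pred : hcoef (sn ^+ p.-1) p.-1 = -1.
Proof. by rewrite hcoef_exp_diag // hsine1 expr1n mulr1 Wilson_pchar. Qed.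

(** For F = s ^ (p - 1), the series D ^ (p - 1) F - h F has derivative D ^ p F - h F' = 0. Its
    constant term is (p - 1)! = - 1 by Wilson's theorem. *)
Lemma hcoef_hsineX_rec n :
  hcoef (sn ^+ p.-1) (n + p.-1) = h * hcoef (sn ^+ p.-1) n - (n == 0)%:R.
Proof.
set F := sn ^+ p.-1.
have p1 : p = p.-1.+1 by rewrite prednK ?prime_gt0.
pose G := iter p.-1 (@hderiv K) F - hconst h * F.
have G0 : hderiv G = 0.
  rewrite hderivB hderivM hderiv_const mul0r add0r -iterS -p1.
  by rewrite iter_hderiv_hsineX subrr.
have F0 : hcoef F 0 = 0 by rewrite hcoefX0 hsine0 expr0n pk; case: (k) k_gt0.
have := congr1 (fun f => hcoef f n) (hderiv_eq0 G0).
rewrite hcoefB hcoef_iter_deriv hcoef_constM => /eqP;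
  rewrite subr_eq => /eqP ->.
rewrite addrC hcoefB hcoef_iter_deriv hcoef_constM F0 mulr0 subr0 add0n.
rewrite hcoef_hsineX_pred.
by congr (_ + _); case: n => //=; rewrite oppr0.
Qed.

Lemma hcoef_hsineX_pred_period r t : (r < p.-1)%N ->
  hcoef (sn ^+ p.-1) (r + t * p.-1) =
    - (if (r == 0) && (t != 0) then h ^+ t.-1 else 0).
Proof.
move=> ltrp; elim: t => [|t IHt].
  by rewrite addn0 andbF oppr0 (hexp_low _ ltrp) ?hcoef0.
rewrite mulSn [(p.-1 + _)%N]addnC addnA hcoef_hsineX_rec IHt addn_eq0.
have p1 : (p.-1 != 0)%N by rewrite pk; case: (k) k_gt0.
rewrite muln_eq0 (negPf p1) orbF.
by case: (r == 0); case: t {IHt} => [|t] /=; rewrite ?exprS ?expr0; ring.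
Qed.

(** Up to the unit 10 i + 1, the series is the derivative of s ^ (10 i + 1), so its coefficient of
    index p - 1 is read from D ^ p s ^ (10 i + 1) = h (s ^ (10 i + 1))' at u = 0. *)
Lemma hcoef_hsineX_cosine i : (i < k)%N ->
  hcoef (sn ^+ (10 * i) * cn) p.-1 = h * (i == 0)%:R.
Proof.
move=> ltik.
have i10 : (10 * i).+1%:R != 0 :> K.
  rewrite -(dvdn_pcharf pcharKp); apply/negP => /dvdn_leq.
  by rewrite pk => /(_ isT); lia.
apply: (mulfI i10);
  rewrite -hcoef_natM mulrA -[(10 * i)%N]/((10 * i).+1.-1) -hderivX.
have p1 : p = p.-1.+1 by rewrite prednK ?prime_gt0.
transitivity (hcoef (iter p (@hderiv K) (sn ^+ (10 * i).+1)) 0).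
  by rewrite [in RHS]p1 iterSr hcoef_iter_deriv.
rewrite iter_hderiv_hsineX hcoef_constM hderivX -mulrA hcoef_natM hcoefM0
  hcoefX0.
by rewrite hcosine0 hsine0 expr0n /= muln_eq0 /=; ring.
Qed.

(** Expand 1 = s' ^ p = (1 - s ^ 10) ^ (5 k) s' and take the coefficient of index p - 1, which is 0:
    the term i = 0 gives h and the term i = k gives - A_p. *)
Lemma hsine_coef_p : h = (A p)%:~R.
Proof.
have p10 : p.-1 = (10 * k)%N by rewrite pk.
have Ap : A p = (-1) ^+ k * 'C(5 * k, k)%:Z.
  rewrite /A p10 mulKn //; congr (_ * ('C(_, _))%:Z).
  by rewrite -[10%N]/(5 * 2)%N mulnAC mulnK.
have hconstN1X i : hconst ((-1) ^+ i) = (-1) ^+ i :> hurwitz K.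
  elim: i => // i IHi; rewrite !exprS hconstM IHi; congr (_ * _).
  by apply: hurwitzP => -[|n] //=; rewrite oppr0.
have : hcoef (cn ^+ p) p.-1 = 0.
  by rewrite hcosine_pchar p10; case: (k) k_gt0.
rewrite [in cn ^+ _]pk exprSr -[10%N]/(2 * 5)%N -mulnA exprM hderiv_hsine_sqr.
rewrite exprBn mulr_suml hcoef_sum.
under eq_bigr => i _.
  rewrite expr1n mulr1 -exprM -hconstN1X -mulr_natl -!mulrA hcoef_natM
    hcoef_constM.
  over.
have lt5k : (k < (5 * k).+1)%N by lia.
rewrite (bigD1 (Ordinal lt5k) isT) (bigD1 ord0); last first.
  by rewrite -val_eqE /= eq_sym -lt0n.
rewrite -[nat_of_ord (Ordinal lt5k)]/k -[nat_of_ord ord0]/0%N.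
(* The other terms vanish: for 0 < i < k by [hcoef_hsineX_cosine], for i > k because s ^ p = 0. *)
rewrite big1 => [|i /andP[/andP[_ neik] nei0]]; last first.
  have [ltik|leki] := ltnP i k.
    rewrite hcoef_hsineX_cosine // (_ : (i == 0 :> nat) = false) ?mulr0 //.
    by apply/negbTE.
  rewrite hsine_pchar ?mul0r ?hcoef0 ?mulr0 // pk.
  by move: neik; rewrite -val_eqE /=; lia.
rewrite -[X in X -> _]/(_ + (_ + 0) = 0).
rewrite (hcoef_hsineX_cosine (i := 0)) // bin0 addr0 !mul1r mulr1 -p10.
rewrite hcoefM_low; last by apply: hexp_low.
rewrite hcoef_hsineX_pred hcosine0 mulr1 mulrN1 mulrN => /eqP.
rewrite addrC subr_eq0 => /eqP ->.
by rewrite Ap rmorphM rmorphXn rmorphN1 mulrC.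
Qed.

(** This is c_(p - 1) = A_p modulo p: the j-th central binomial coefficient is (- 4) ^ j times the
    binomial coefficient of - 1/2 over j, and 5 k = (p - 1) / 2 is - 1/2 modulo p. *)
Lemma central_bin_pchar :
  'C(k.*2, k)%:R = (4 ^ k)%:R * (A p)%:~R :> K.
Proof.
have p10 : p.-1 = (10 * k)%N by rewrite pk.
have -> : A p = (-1) ^+ k * 'C(5 * k, k)%:Z.
  rewrite /A p10 mulKn //; congr (_ * ('C(_, _))%:Z).
  by rewrite -[10%N]/(5 * 2)%N mulnAC mulnK.
rewrite rmorphM rmorphXn rmorphN1 natrX mulrA -exprMn mulrN1.
suff key j : (j <= k)%N ->
  'C(j.*2, j)%:R = (- 4) ^+ j * 'C(5 * k, j)%:R :> K by exact: key.
elim: j => [|j IHj] ltjk; first by rewrite !bin0 mul1r.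
have j1 : j.+1%:R != 0 :> K.
  rewrite -(dvdn_pcharf pcharKp); apply/negP => /dvdn_leq.
  by rewrite pk => /(_ isT); lia.
have k10 : (10 * k)%:R = -1 :> K.
  by apply/eqP; rewrite -subr_eq0 opprK natr1 -pk (pcharf0 pcharKp).
apply: (mulfI j1); rewrite -natrM central_bin_rec !natrM IHj; last exact: ltnW.
rewrite [RHS]mulrCA -[in RHS]natrM mul_bin_left natrM natrB; last by lia.
have -> : j.*2.+1%:R = j%:R * 2 + 1 :> K by rewrite -natr1 -muln2 natrM.
rewrite exprS natrM.
transitivity ((- 4) ^+ j * 'C(5 * k, j)%:R * (2 + 4 * j%:R) : K); first by ring.
transitivity ((- 4) ^+ j * 'C(5 * k, j)%:R * (- 2 * (10 * k)%:R + 4 * j%:R) : K).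
  by rewrite k10; ring.
by rewrite natrM; ring.
Qed.

Lemma hcoef_sine_pchar m : (0 < m)%N ->
  'C(k.*2, k)%:R * hcoef (sn ^+ p.-1) m =
  - (if (p.-1 %| m)%N then (4 ^ k)%:R * (A p)%:~R ^+ (m %/ p.-1) else 0).
Proof.
move=> m_gt0; have p1 : (0 < p.-1)%N by rewrite pk; case: (k) k_gt0.
rewrite {1}(divn_eq m p.-1) addnC hcoef_hsineX_pred_period ?ltn_mod //
  -/(dvdn _ _).
rewrite hsine_coef_p central_bin_pchar mulrN.
case: ifP => [/andP[-> ]|]; last first.
  case: ifP => [pm|]; rewrite ?mulr0 //= => /negbT /negPn /eqP.
  by move: m_gt0; rewrite -{1}(divnK pm) => + d0; rewrite d0.
by case: (m %/ p.-1)%N => // t _; rewrite exprS mulrA.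
Qed.

End SineModP.

(** * Denominators *)

Lemma dvdn_fact2 a b : (a`! * b`! %| (a + b)`!)%N.
Proof.
apply/dvdnP; exists 'C(a + b, a).
by rewrite -(bin_fact (leq_addr b a)) addKn.
Qed.

Lemma dvdn_fact_fact a b : (a <= b)%N -> (a`! %| b`!)%N.
Proof.
by move=> leab; rewrite -(subnKC leab); apply: dvdn_trans (dvdn_fact2 _ _);
  apply: dvdn_mulr.
Qed.

(** The base case is 96 dividing 8!; each further k contributes a factor 10!, divisible by 4. *)
Lemma dvdn_24_fact k : (0 < k)%N -> (24 * 4 ^ k %| (10 * k - 2)`!)%N.
Proof.
case: k => // k _; elim: k => [|k IHk]; first by [].
have -> : (10 * k.+2 - 2 = (10 * k.+1 - 2) + 10)%N by lia.
apply: dvdn_trans (dvdn_fact2 _ _); rewrite expnSr mulnA.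
by apply: dvdn_mul IHk (dvdn_fact _).
Qed.

Lemma dvdn_composite_fact k : (0 < k)%N -> ~~ prime (10 * k).+1 ->
  (24 * 4 ^ k * (10 * k).+1 %| (10 * k)`!)%N.
Proof.
move=> k_gt0 /primePn[|[a /andP[a1 aN] /dvdnP[b Nab]]]; first by lia.
have oddN : odd (b * a) by rewrite -Nab /= oddM.
have [a3 b3] : (2 < a)%N /\ (2 < b)%N.
  move: oddN; rewrite oddM => /andP[]; case: b Nab => [|[|[|b]]] //;
    first by lia.
  by case: a a1 aN => [|[|[|a]]].
(* This leaves room for a! b! 3! to divide (10 k)!, which yields 3 (10 k + 1) even when a, b and 3
   share factors. The remaining 8 * 4 ^ k is coprime to it. *)
have leabN : (a + b + 3 <= 10 * k)%N.
  have [a4|a4] := leqP 4 a.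
    have [[a' aE] [b' bE]] : (exists a' : nat, a = a' + 4)%N /\ (exists b' : nat, b = b' + 3)%N.
      by split; [exists (a - 4)%N | exists (b - 3)%N]; lia.
    by move: Nab; rewrite aE bE; nia.
  have aE : a = 3%N by lia.
  by move: Nab; rewrite aE; lia.
have -> : (24 * 4 ^ k * (10 * k).+1 = (8 * 4 ^ k) * (3 * (10 * k).+1))%N by lia.
rewrite Gauss_dvd; last first.
  rewrite coprimeMl !coprimeXl //.
  - by rewrite -[8%N]/(2 ^ 3)%N coprimeXl // coprime2n oddM Nab.
  - by rewrite -[4%N]/(2 ^ 2)%N coprimeXl // coprime2n oddM Nab.
apply/andP; split.
  have d1 : (24 * 4 ^ k %| (10 * k)`!)%N.
    by apply: dvdn_trans (dvdn_24_fact k_gt0) _; apply: dvdn_fact_fact; lia.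
  by apply: dvdn_trans d1; apply: dvdn_mul.
apply: dvdn_trans (dvdn_fact_fact leabN); apply: dvdn_trans (dvdn_fact2 _ _).
rewrite mulnC; apply: dvdn_mul => //; rewrite Nab mulnC.
apply: dvdn_trans (dvdn_fact2 _ _).
by apply: dvdn_mul; apply: dvdn_fact; lia.
Qed.

Lemma hsine_rat_coef i m : hcoef ((@hsine rat) ^+ i) m =
  (hcoef (sine ^+ i) m)%:~R.
Proof. by rewrite /hsine -rmorphXn. Qed.

Lemma sineX_coef i m : hcoef (sine ^+ i) m = i`!%:R * hcoef (hdpow sine i) m.
Proof. by rewrite hexp_hdpow // hcoef_natM. Qed.

Lemma dvdn_int_num d n : (0 < d)%N -> (d %| n)%N ->
  (n%:R / d%:R : rat) \is a Num.int.
Proof.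
move=> d_gt0 /dvdnP[q ->]; rewrite natrM mulfK ?pnatr_eq0 -?lt0n //.
Qed.

Lemma dvdz_int_num (d : nat) (z : int) :
  (d %| z)%Z -> (z%:~R / d%:R : rat) \is a Num.int.
Proof.
move=> /dvdzP[q ->]; have [->|d0] := eqVneq d 0%N; first by rewrite invr0 mulr0.
by rewrite rmorphM /= mulfK ?pnatr_eq0 // intr_int.
Qed.

(** Only i = 10 k - 1 matters. The factor i! of s ^ i, divided by i, is (10 k - 2)!, which absorbs
    24 * 4 ^ k. *)
Lemma int_num_first_term i m :
  invsqrt_coef i.+1 / i%:R * hcoef ((@hsine rat) ^+ i) m / 24%:R \is a Num.int.
Proof.
rewrite /invsqrt_coef; case: ifP => [/dvdnP[k ik]|_]; last by rewrite !mul0r.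
have k_gt0 : (0 < k)%N by case: k ik.
rewrite ik mulnK // hsine_rat_coef sineX_coef.
have i_gt0 : (0 < i)%N by lia.
have fact_i : i`! = (i * (10 * k - 2)`!)%N.
  by case: (i) i_gt0 ik => // j _ ik; rewrite factS; congr (_ * _`!)%N; lia.
rewrite rmorphM /= rmorph_nat fact_i natrM.
set c := 'C(_, _)%:R; set z := (hcoef _ _)%:~R.
have i0 : i%:R != 0 :> rat by rewrite pnatr_eq0 -lt0n.
have k4 : (4 ^ k)%:R != 0 :> rat by rewrite pnatr_eq0 expn_eq0.
have -> : c / (4 ^ k)%:R / i%:R * (i%:R * (10 * k - 2)`!%:R * z) / 24%:R =
    c * z * ((10 * k - 2)`!%:R / (24 * 4 ^ k)%:R).
  by rewrite natrM; field; rewrite k4 i0.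
apply: rpredM; first by rewrite rpredM ?rpred_nat ?intr_int.
by rewrite dvdn_int_num ?dvdn_24_fact // muln_gt0 expn_gt0.
Qed.

(** The summand - c_j / (j + 1) * (s ^ j)_m, indexed by its denominator p = j + 1. *)
Definition log_term (p m : nat) : rat :=
  - (invsqrt_coef p.-1 / p%:R * hcoef ((@hsine rat) ^+ p.-1) m).

Lemma log_term_composite p m : (0 < m)%N -> ~~ prime p ->
  log_term p m / 24%:R \is a Num.int.
Proof.
move=> m_gt0; rewrite /log_term /invsqrt_coef; case: ifP => [/dvdnP[k pk]|_];
  last by rewrite !mul0r ?oppr0 ?mul0r.
(* The case k = 0 covers p = 0 and p = 1, where s ^ 0 = 1 has no coefficient of positive index. *)
have [k0|k_gt0] := posnP k.
  by rewrite pk k0 expr0; case: m m_gt0 => // m _ _;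
    rewrite -[hcoef 1 m.+1]/(0 : rat) mulr0 oppr0 mul0r.
have {1}-> : p = (10 * k).+1 by lia.
move=> p_comp; rewrite pk mulnK // hsine_rat_coef sineX_coef.
rewrite rmorphM /= rmorph_nat.
set c := 'C(_, _)%:R; set z := (hcoef _ _)%:~R.
have k4 : (4 ^ k)%:R != 0 :> rat by rewrite pnatr_eq0 expn_eq0.
have p0 : p%:R != 0 :> rat by rewrite pnatr_eq0; lia.
have -> : - (c / (4 ^ k)%:R / p%:R * ((k * 10)`!%:R * z)) / 24%:R =
    - (c * z * ((10 * k)`!%:R / (24 * 4 ^ k * p)%:R)).
  by rewrite [(k * 10)%N]mulnC !natrM; field; rewrite k4 p0.
have pE : p = (10 * k).+1 by lia.
rewrite rpredN; apply: rpredM; first by rewrite rpredM ?rpred_nat ?intr_int.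
rewrite pE in p_comp *; rewrite dvdn_int_num ?dvdn_composite_fact //.
by rewrite !muln_gt0 expn_gt0.
Qed.

(** Since 24 * 4 ^ k divides (p - 1)!, the term equals - 24 W / p with W an integer. The computation
    modulo p gives 24 W = - E, and then W = - b E. *)
Lemma log_term_prime k p m (b : int) : prime p -> p = (10 * k).+1 ->
  (0 < m)%N ->
  (24 * b = 1 %[mod p])%Z ->
  let E := if (p.-1 %| m)%N then A p ^+ (m %/ p.-1) else 0 in
  log_term p m - E%:~R / p%:R \is a Num.int /\
  log_term p m / 24%:R - (b * E)%:~R / p%:R \is a Num.int.
Proof.
move=> p_prime pk m_gt0 b24 E.
have k_gt0 : (0 < k)%N by have := prime_gt1 p_prime; rewrite pk; case: (k).
have p10 : p.-1 = (10 * k)%N by rewrite pk.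
have /dvdnP[q qE] : (24 * 4 ^ k %| p.-1`!)%N.
  by rewrite p10; apply: dvdn_trans (dvdn_24_fact k_gt0) _;
    apply: dvdn_fact_fact; lia.
pose W : int := 'C(k.*2, k)%:Z * q%:Z * hcoef (hdpow sine p.-1) m.
have p0 : p%:R != 0 :> rat by rewrite pnatr_eq0 -lt0n prime_gt0.
have k4 : (4 ^ k)%:R != 0 :> rat by rewrite pnatr_eq0 expn_eq0.
have termE : log_term p m = - (24 * W)%:~R / p%:R.
  rewrite /log_term /invsqrt_coef p10 dvdn_mulr // mulKn // -p10.
  rewrite hsine_rat_coef sineX_coef !rmorphM /= !rmorph_nat qE !natrM.
  by rewrite -!pmulrn; field; rewrite k4 p0.
have W24 : (p %| 24 * W + E)%Z.
  have pFp := pchar_Fp p_prime.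
  rewrite (dvdz_pcharf pFp).
  have F4 : (4 ^ k)%:R != 0 :> 'F_p.
    rewrite -(dvdn_pcharf pFp) Euclid_dvdX // k_gt0 andbT.
    by apply/negP => /dvdn_leq; rewrite pk => /(_ isT); lia.
  rewrite -(mulrI_eq0 _ (mulfI F4)).
  have := hcoef_sine_pchar pFp pk m_gt0.
  have -> : hcoef (@hsine 'F_p ^+ p.-1) m = (hcoef (sine ^+ p.-1) m)%:~R.
    by rewrite /hsine -rmorphXn.
  rewrite sineX_coef qE /W => e; apply/eqP.
  transitivity ('C(k.*2, k)%:R * ((q * (24 * 4 ^ k))%:R * hcoef (hdpow sine p.-1) m)%:~R
      + (4 ^ k)%:R * E%:~R : 'F_p).
    by rewrite !rmorphD !rmorphM /= !rmorph_nat !natrM -!pmulrn; ring.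
  rewrite e /E; case: ifP => _; last by rewrite oppr0 mulr0 addr0.
  by rewrite rmorphXn addNr.
have Wb : (p %| W + b * E)%Z.
  have -> : W + b * E = b * (24 * W + E) - W * (24 * b - 1) by ring.
  by rewrite rpredB ?dvdz_mull // -eqz_mod_dvd; apply/eqP.
rewrite termE; split.
  have -> : - (24 * W)%:~R / p%:R - E%:~R / p%:R =
    - ((24 * W + E)%:~R / p%:R) :> rat.
    by rewrite rmorphD /=; ring.
  by rewrite rpredN dvdz_int_num.
have -> : - (24 * W)%:~R / p%:R / 24%:R - (b * E)%:~R / p%:R =
    - ((W + b * E)%:~R / p%:R) :> rat.
  by rewrite rmorphD rmorphM /=; field.
by rewrite rpredN dvdz_int_num.
Qed.

Lemma log_term_admissible n p (b : int) : (0 < n)%N ->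
  (prime p -> p = 1 %[mod 5] -> (24 * b = 1 %[mod p])%Z)%N ->
  let a := if admissible n p then A p ^+ (10 * n %/ p.-1) else 0 in
  log_term p (10 * n) - a%:~R / p%:R \is a Num.int /\
  log_term p (10 * n) / 24%:R - (b * a)%:~R / p%:R \is a Num.int.
Proof.
move=> n_gt0 hb a; have m_gt0 : (0 < 10 * n)%N by lia.
have [p_prime|p_comp] := boolP (prime p); last first.
  have int_log := log_term_composite m_gt0 p_comp.
  rewrite /a /admissible (negPf p_comp) /= mulr0 !mul0r !subr0; split=> //.
  by rewrite -[log_term _ _](@divfK _ 24%:R) // rpredM ?rpred_nat.
have p_gt1 := prime_gt1 p_prime.
have [p1|pn1] := boolP (p == 1 %[mod 5])%N; last first.
  (* Here 10 does not divide p - 1, so c_(p - 1) = 0. *)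
  have -> : log_term p (10 * n) = 0.
    rewrite /log_term /invsqrt_coef; case: ifP => [/dvdnP[k pk]|_];
      last by rewrite !mul0r oppr0.
    by case/negP: pn1; apply/eqP; lia.
  by rewrite /a /admissible p_prime (negPf pn1) /= mulr0 !mul0r subr0.
have odd_p : odd p by case: (even_prime p_prime) p1 => // ->.
have pk : p = (10 * (p.-1 %/ 10)).+1.
  by move/eqP: p1; rewrite -[in LHS](odd_double_half p) odd_p; lia.
have := log_term_prime p_prime pk m_gt0 (hb p_prime (eqP p1)).
by rewrite /a /admissible p_prime p1.
Qed.

(** * The numbers C and D modulo integers *)

Lemma C10E x y n : expansion_at_infinity x y -> (0 < n)%N ->
  (C10 x n - \sum_(0 <= p < (10 * n).+2) log_term p (10 * n)) / 24%:R \is a Num.int.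
Proof.
move=> hxy n_gt0; set m := (10 * n)%N.
have [M mM] : exists M, m = M.+2 by exists (m - 2)%N; rewrite /m; lia.
(* The normalization (m - 2)! m / m! = 1 / (m - 1) cancels the outer factor m - 1 of
   [hcoef_xnum]. *)
have -> : C10 x n =
  M.+2%:R * \sum_(i < M.+2) invsqrt_coef i.+1 / i%:R * hcoef ((@hsine rat) ^+ i) M.+1
     - \sum_(j < M.+3) invsqrt_coef j / j.+1%:R * hcoef ((@hsine rat) ^+ j) M.+2.
  rewrite /C10 -/m.
  have [+ _] := expansion_num hxy m.
  have -> : m%:Z - 2 = (m - 2)%N%:Z by lia.
  move=> ->; rewrite mM hcoef_xnum subSS subSS subn0 2!factS !natrM.
  have f0 : M`!%:R != 0 :> rat by rewrite pnatr_eq0 -lt0n fact_gt0.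
  have M1 : M.+1%:R != 0 :> rat by rewrite pnatr_eq0.
  have M2 : M.+2%:R != 0 :> rat by rewrite pnatr_eq0.
  set c := _ - _; move: f0 M1 M2;
    move: M`!%:R M.+1%:R M.+2%:R => f m1 m2 f0 m10 m20.
  by field; rewrite m10 m20 f0.
rewrite big_ltn // [log_term 0 m](_ : _ = 0); last first.
  by rewrite /log_term invr0 mulr0 mul0r oppr0.
rewrite add0r big_add1 big_mkord mM -addrA -opprD -big_split [X in _ - X]big1;
  last first.
  by move=> j _; apply: addrN.
rewrite subr0 -mulrA rpredM ?rpred_nat // mulr_suml rpred_sum // => i _.
exact: int_num_first_term.
Qed.

(** After normalization, x''' = 24 y + 24 s ^ 5 s' reads C = 24 D + 24 m Z, where m = 10 n and Z is
    the integral coefficient of index m - 5 of s ^ 5 s'. *)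
Lemma D10E x y n : expansion_at_infinity x y -> (0 < n)%N ->
  D10 y n - C10 x n / 24%:R \is a Num.int.
Proof.
move=> hxy n_gt0; rewrite /D10 /C10; set m := (10 * n)%N.
have [l ml] : exists l, m = (l + 5)%N by exists (m - 5)%N; rewrite /m; lia.
clearbody m.
have [+ +] := expansion_num hxy m.
have -> : m%:Z - 2 = (m - 2)%N%:Z by lia.
have -> : m%:Z - 5 = (m - 5)%N%:Z by lia.
move=> -> ->; have := hcoef_ynum l; rewrite -ml.
have -> : hcoef ((@hsine rat) ^+ 5 * hderiv hsine) l =
  (hcoef (sine ^+ 5 * hderiv sine) l)%:~R.
  by rewrite /hsine hderiv_hmap -rmorphXn -rmorphM.
set X := hcoef xnum m; set Z := hcoef _ l => Y24.
have -> : hcoef ynum m = ((l + 3)%:R * (l + 2)%:R * (l + 1)%:R * X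
    - 24%:R * ((m ^_ 5)%:R * Z%:~R)) / 24%:R.
  by rewrite -Y24 mulrC mulKf.
have -> : (m ^_ 5 = m * (l + 4) * (l + 3) * (l + 2) * (l + 1))%N.
  by rewrite ml !ffactnS ffactn0; lia.
have -> : (m - 5 = l)%N by lia.
have f2 : ((m - 2)`! = (l + 3) * ((l + 2) * ((l + 1) * l`!)))%N.
  by rewrite !addnS addn0 -!factS ml; congr (_`!); lia.
have fm : (m`! = m * ((l + 4) * (m - 2)`!))%N.
  by rewrite f2 ml !addnS addn0 -!factS.
rewrite fm f2 !natrM.
have nz j : (l + j.+1)%:R != 0 :> rat by rewrite pnatr_eq0 addnS.
have f0 : l`!%:R != 0 :> rat by rewrite pnatr_eq0 -lt0n fact_gt0.
have m0 : m%:R != 0 :> rat by rewrite ml nz.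
rewrite [w in w \is a _](_ : _ = - (m%:R * Z%:~R)).
  by rewrite rpredN rpredM ?rpred_nat ?intr_int.
move: (nz 0) (nz 1) (nz 2) (nz 3) m0 f0.
move: m%:R (l + 1)%:R (l + 2)%:R (l + 3)%:R (l + 4)%:R l`!%:R => m' l1 l2 l3 l4
  f.
by move=> l10 l20 l30 l40 m0 f0; field; rewrite l10 l20 l30 l40 m0 f0.
Qed.

Theorem theorem2p7 (x y : laurent rat) (hxy : expansion_at_infinity x y)
    (inv24 : nat -> int)
    (hinv : forall p : nat, prime p -> (p = 1 %[mod 5])%N ->
              (4`!%:Z * inv24 p = 1 %[mod p%:Z])%Z)
    (n : nat) (hn : (1 <= n)%N) :
  exists G H : int,
    C10 x n =
      \sum_(0 <= p < (10 * n).+2 | admissible n p)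
         (A p ^+ (10 * n %/ p.-1))%:~R / p%:R + G%:~R
    /\
    D10 y n =
      \sum_(0 <= p < (10 * n).+2 | admissible n p)
         (inv24 p * A p ^+ (10 * n %/ p.-1))%:~R / p%:R + H%:~R.
Proof.
set SC := \sum_(_ <= p < _ | _) _;
  set SD := \sum_(_ <= p < _ | _) (inv24 p * _)%:~R / _.
pose L := \sum_(0 <= p < (10 * n).+2) log_term p (10 * n).
pose a p := if admissible n p then A p ^+ (10 * n %/ p.-1) else 0.
have loc p := log_term_admissible (b := inv24 p) hn (hinv p).
have LC : L - SC \is a Num.int.
  rewrite /SC (eq_bigr (fun p => (a p)%:~R / p%:R));
    last by move=> p; rewrite /a => ->.
  rewrite big_mkcond -sumrB rpred_sum // => p _.
  by have [+ _] := loc p; rewrite /a; case: ifP => //; rewrite mul0r.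
have LD : L / 24%:R - SD \is a Num.int.
  rewrite /SD (eq_bigr (fun p => (inv24 p * a p)%:~R / p%:R));
    last by move=> p; rewrite /a => ->.
  rewrite big_mkcond mulr_suml -sumrB rpred_sum // => p _.
  by have [_ +] := loc p; rewrite /a; case: ifP => //; rewrite mulr0 mul0r.
have CL := C10E hxy hn; rewrite -/L in CL.
have /intrP[G CG] : C10 x n - SC \is a Num.int.
  have -> : C10 x n - SC = 24%:R * ((C10 x n - L) / 24%:R) + (L - SC) by field.
  by rewrite rpredD // rpredM ?rpred_nat.
have /intrP[H DH] : D10 y n - SD \is a Num.int.
  (* The middle term is an integer because C and the sum of the [log_term] agree modulo 24, not only
     modulo 1. *)
  have -> : D10 y n - SD =
    (D10 y n - C10 x n / 24%:R) + (C10 x n - L) / 24%:R + (L / 24%:R - SD)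
      by field.
  by rewrite rpredD // rpredD // D10E.
by exists G, H; split; apply/eqP; rewrite addrC -subr_eq ?CG ?DH.
Qed.
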